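(* Consider $T\ge 1$ rounds ($t=0,\dots,T-1$) of FedSGD with over-the-air aggregation as described in the context, with receive scaling factors $\eta_t>0$ and learning rate $\lambda>0$. Assume: A1 (smoothness): for every $m$ and all $\mathbf{w},\mathbf{w}'\in\mathbb{R}^d$, $f_m(\mathbf{w})\le f_m(\mathbf{w}')+\langle\nabla f_m(\mathbf{w}'),\mathbf{w}-\mathbf{w}'\rangle+\frac{L}{2}\|\mathbf{w}-\mathbf{w}'\|^2$. A2 (global minimum): there is $\mathbf{w}^\star\in\mathbb{R}^d$ with $f(\mathbf{w}^\star)=f^\star\le f(\mathbf{w})$ for all $\mathbf{w}\in\mathbb{R}^d$. A3 (unbiased sample gradients with bounded variance): there are $A_1,A_2\ge 0$ such that, for all $m,t,i$, $\mathbf{g}_{m,t,i}=\nabla f_m(\mathbf{w}_t)+\mathbf{z}_{m,t,i}$ with $\mathbb{E}[\mathbf{z}_{m,t,i}\mid\mathbf{w}_t]=0$ and $\mathbb{E}[\|\mathbf{z}_{m,t,i}\|^2\mid\mathbf{w}_t]\le A_1\|\nabla f_m(\mathbf{w}_t)\|^2+A_2$. A4 (bounded similarity): there are $C_1,C_2\ge 0$ such that for all $\mathbf{w}\in\mathbb{R}^d$, $\frac1M\sum_{m=1}^M\|\nabla f_m(\mathbf{w})-\nabla f(\mathbf{w})\|^2\le C_1\|\nabla f(\mathbf{w})\|^2+C_2$. If $\lambda\le\frac{1}{4L(C_1+1)(A_1+1)}$, then $$\frac1T\sum_{t=0}^{T-1}\mathbb{E}\|\nabla f(\mathbf{w}_t)\|^2\le\phi+\frac{L\lambda}{2T}\sum_{t=0}^{T-1}\frac{d\sigma_n^2}{\eta_t},$$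 where $$\phi=\frac{2\big(f(\mathbf{w}_0)-f^\star\big)}{\lambda T}+2L\lambda\Big(2C_2(A_1+1)+A_2\Big).$$
   Context: FedSGD with over-the-air (OTA) aggregation. There are $M\ge1$ devices; device $m$ has a dataset of $n_m$ samples $(\mathbf{u}_{m,i},o_{m,i})$, $1\le i\le n_m$, with data distribution $p_m$, and a differentiable local loss $f_m:\mathbb{R}^d\to\mathbb{R}$, $f_m(\mathbf{w})=\mathbb{E}_{(\mathbf{u},o)\sim p_m}[c_m l(\mathbf{w};(\mathbf{u},o))]$, where $l$ is a sample-wise loss and $c_m\in\mathbb{R}$. The global loss is $f(\mathbf{w})=\frac1M\sum_{m=1}^M f_m(\mathbf{w})$. $L>0$ denotes the smoothness constant. The initial model $\mathbf{w}_0\in\mathbb{R}^d$ is deterministic. In round $t$, given the model $\mathbf{w}_t$: (1) Each device $m$ forms a random batch $\mathcal{B}_{m,t}\subseteq\{1,\dots,n_m\}$ by Poisson sampling: each index is included independently with probability $q_m=B_m/n_m$, where $B_m$ is the expected batch size, an integer with $1\le B_m\le n_m$. The batch sampling is independent of $\mathbf{w}_t$ and of the sample gradients. (2) Device $m$ computes $\mathbf{g}_{m,t}=\frac{1}{B_m}\sum_{i\in\mathcal{B}_{m,t}}\mathbf{g}_{m,t,i}$, where $\mathbf{g}_{m,t,i}=c_m\nabla l(\mathbf{w}_t;(\mathbf{u}_{m,i},o_{m,i}))\in\mathbb{R}^d$ is the (random) sample gradient. It is a standing assumption that $\|\mathbf{g}_{m,t,i}\|\le G$ for all $m,t,i$.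 (3) Device $m$ transmits $a_{m,t}\mathbf{g}_{m,t}$ with $a_{m,t}=\frac{\sqrt{\eta_t}}{M h_{m,t}}$, where $h_{m,t}\in\mathbb{C}\setminus\{0\}$ is the channel coefficient and $\eta_t>0$ the receive scaling factor (channels and scaling factors are treated as deterministic). The server receives $\mathbf{r}_t=\sum_m h_{m,t}a_{m,t}\mathbf{g}_{m,t}+\mathbf{n}_t$, with $\mathbf{n}_t\sim\mathcal{CN}(0,\sigma_n^2\mathbb{I}^d)$, $\sigma_n>0$, independent of $\mathbf{w}_t$, the batches and the sample gradients. (4) The server updates $\mathbf{w}_{t+1}=\mathbf{w}_t-\lambda\frac{\mathrm{Re}(\mathbf{r}_t)}{\sqrt{\eta_t}}=\mathbf{w}_t-\lambda(\mathbf{s}_t+\tilde{\mathbf{n}}_t)$, where $\mathbf{s}_t=\frac1M\sum_{m=1}^M\mathbf{g}_{m,t}$ and $\tilde{\mathbf{n}}_t=\mathrm{Re}(\mathbf{n}_t)/\sqrt{\eta_t}\sim\mathcal{N}(0,\frac{\sigma_n^2}{2\eta_t}\mathbb{I}^d)$. $\mathbb{E}$ is over the batch sampling, the noise of the sample gradients, and the receiver noise. *)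

(* Defs.v *)
(* MathComp-Analysis, over an arbitrary [R : realType]. *)
From HB Require Import structures.
From mathcomp Require Import all_boot all_order all_algebra.
From mathcomp Require Import all_classical all_reals all_analysis.
From mathcomp Require Import complex.

Set Implicit Arguments.
Unset Strict Implicit.
Unset Printing Implicit Defensive.

Import Order.TTheory GRing.Theory Num.Theory.
Import numFieldNormedType.Exports.

Local Open Scope classical_set_scope.
Local Open Scope ring_scope.
Local Open Scope complex_scope.

(* The library's norm on ['rV[R]_d] is the sup norm, so the Euclidean one is
   defined here; differentiability does not depend on this choice. *)
Section Euclidean.
Context {R : realType} {d : nat}.
Implicit Types u v : 'rV[R]_d.

Definition dotv u v : R := \sum_(j < d) u ord0 j * v ord0 j.

Definition enorm v : R := Num.sqrt (dotv v v).

(* Equal to the gradient only where [f] is differentiable. *)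
Definition gradient (f : 'rV[R]_d -> R) (x : 'rV[R]_d) : 'rV[R]_d :=
  \row_(j < d) 'D_(delta_mx ord0 j) f x.

Definition smooth (L : R) (f : 'rV[R]_d -> R) : Prop :=
  forall x y, f x <= f y + dotv (gradient f y) (x - y)
                     + L / 2 * enorm (x - y) ^+ 2.

End Euclidean.

Section Probability.
Context {d : measure_display} {Omega : measurableType d} {R : realType}.
Variable P : probability Omega R.

Definition independent_sigma (F G : set (set Omega)) : Prop :=
  forall A B, F A -> G B -> P (A `&` B) = (P A * P B)%E.

Definition mutually_independent (I : finType) (F : I -> set (set Omega)) :
    Prop :=
  forall (J : {set I}) (A : I -> set Omega),
    (forall i, i \in J -> F i (A i)) ->
    P (\bigcap_(i in [set` J]) A i) = (\prod_(i in J) P (A i))%E.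

Definition sigma_rv (X : Omega -> R) : set (set Omega) :=
  preimage_set_system [set: Omega] X measurable.

Definition sigma_vec (k : nat) (X : Omega -> 'rV[R]_k) : set (set Omega) :=
  <<s \bigcup_(j in [set: 'I_k]) sigma_rv (fun o => X o ord0 j) >>.

Definition sigma_cvec (k : nat) (X : Omega -> 'rV[R[i]]_k) :
    set (set Omega) :=
  <<s sigma_vec (fun o => map_mx (@complex.Re R) (X o))
      `|` sigma_vec (fun o => map_mx (@complex.Im R) (X o)) >>.

(* Random elements of a finite type, which carries its discrete
   sigma-algebra. *)
Definition sigma_fin (T : finType) (X : Omega -> T) : set (set Omega) :=
  preimage_set_system [set: Omega] X [set: set T].

Definition random_vector (k : nat) (X : Omega -> 'rV[R]_k) : Prop :=
  forall j, measurable_fun [set: Omega] (fun o => X o ord0 j).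

(* [Y] is a version of the conditional expectation of [X] given the
   sub-sigma-algebra [G]. *)
Definition is_cond_exp (G : set (set Omega)) (X Y : Omega -> R) : Prop :=
  [/\ P.-integrable [set: Omega] (EFin \o X),
      P.-integrable [set: Omega] (EFin \o Y),
      forall B, measurable B -> G (Y @^-1` B)
    & forall A, G A ->
        (\int[P]_(o in A) (Y o)%:E = \int[P]_(o in A) (X o)%:E)%E].

Definition poisson_sampling (n : nat) (q : R) (batch : Omega -> {set 'I_n}) :
    Prop :=
  [/\ forall i, measurable [set o | i \in batch o],
      forall i, P [set o | i \in batch o] = q%:E
    & mutually_independent (fun i => [set [set o | i \in batch o]])].

Definition gaussian_rv (v : R) (X : Omega -> R) : Prop :=
  measurable_fun [set: Omega] X /\
  forall A, measurable A ->
    pushforward P X A = normal_prob 0 (Num.sqrt v) A.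

(* CN(0, s2 I): the 2k real and imaginary parts are independent centred
   Gaussians of variance s2 / 2; the boolean selects the imaginary part. *)
Definition circular_gaussian (k : nat) (s2 : R) (X : Omega -> 'rV[R[i]]_k) :
    Prop :=
  let part (jb : 'I_k * bool) (o : Omega) : R :=
    let z := X o ord0 jb.1 in if jb.2 then complex.Im z else complex.Re z in
  (forall jb, gaussian_rv (s2 / 2) (part jb)) /\
  mutually_independent (fun jb => sigma_rv (part jb)).

End Probability.

Section FedSGD.
Context {R : realType} {d : nat}.

Definition local_loss (dS : measure_display) (S : measurableType dS)
    (p : probability S R) (c : R) (l : 'rV[R]_d -> S -> R)
    (x : 'rV[R]_d) : R :=
  fine 'E_p[fun s => c * l x s].

Definition global_loss (M : nat) (f : 'I_M -> 'rV[R]_d -> R)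
    (x : 'rV[R]_d) : R :=
  M%:R^-1 * \sum_(m < M) f m x.

(* Normalised by the expected batch size [B], not by [#|batch|]. *)
Definition device_gradient (n B : nat) (batch : {set 'I_n})
    (g : 'I_n -> 'rV[R]_d) : 'rV[R]_d :=
  B%:R^-1 *: \sum_(i in batch) g i.

Definition precoder (M : nat) (eta : R) (h : R[i]) : R[i] :=
  (Num.sqrt eta)%:C / (M%:R * h).

Definition received (M : nat) (eta : R) (h : 'I_M -> R[i])
    (g : 'I_M -> 'rV[R]_d) (noise : 'rV[R[i]]_d) : 'rV[R[i]]_d :=
  \sum_(m < M)
    (h m * precoder M eta (h m)) *: map_mx (real_complex R) (g m) + noise.

Definition server_update (lambda eta : R) (x : 'rV[R]_d)
    (r : 'rV[R[i]]_d) : 'rV[R]_d :=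
  x - (lambda / Num.sqrt eta) *: map_mx (@complex.Re R) r.

End FedSGD.

Section Assumptions.
Context {R : realType} {d : nat}.
Context {dO : measure_display} {Omega : measurableType dO}.

(* [grad o] is the true gradient at the random model [w o], [g o] the sample
   gradient. *)
Definition unbiased_bounded_variance (P : probability Omega R) (A1 A2 : R)
    (w grad g : Omega -> 'rV[R]_d) : Prop :=
  let z o := g o - grad o in
  (forall j, is_cond_exp P (sigma_vec w) (fun o => z o ord0 j) (cst 0)) /\
  exists2 V : Omega -> R,
    is_cond_exp P (sigma_vec w) (fun o => enorm (z o) ^+ 2) V
    & {ae P, forall o, V o <= A1 * enorm (grad o) ^+ 2 + A2}.

Definition bounded_similarity (M : nat) (C1 C2 : R)
    (f : 'I_M -> 'rV[R]_d -> R) : Prop :=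
  forall x,
    M%:R^-1 * \sum_(m < M)
        enorm (gradient (f m) x - gradient (global_loss f) x) ^+ 2
    <= C1 * enorm (gradient (global_loss f) x) ^+ 2 + C2.

End Assumptions.

(* Main.v *)
(* One round: smoothness of [f] bounds the decrease by the cross term
   [- lambda <grad f, s + noise>] and the quadratic term
   [L lambda^2 / 2 |s + noise|^2]. Independence of the batches and unbiasedness
   turn the cross term into [- lambda E|grad f|^2]; the noise only adds
   [d sigma^2 / (2 eta)] to the quadratic term. Nothing is known about the joint
   law of different devices or of different samples, so [E|s|^2] is bounded by
   convexity: per device, Cauchy-Schwarz gives
   [|sum_(i in batch) g_i|^2 <= #|batch| sum_(i in batch) |g_i|^2], and
   [E(#|batch| 1_(i in batch)) <= q (1 + n q)], whence
   [E|s|^2 <= 2 ((A1 + 1) mean_m E|grad f_m|^2 + A2)]. The similarity bound and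
   the step size absorb this into half of the cross term, and the rounds
   telescope pathwise, so that [f (w t)] itself is never integrated. *)
Require Import Defs.
From HB Require Import structures.
From mathcomp Require Import all_boot all_order all_algebra.
From mathcomp Require Import all_classical all_reals all_analysis.
From mathcomp Require Import complex.
From mathcomp Require Import measurable_realfun.
From mathcomp Require Import ring lra.
Import Order.TTheory GRing.Theory Num.Theory.
Import numFieldNormedType.Exports.
Local Open Scope classical_set_scope.
Local Open Scope ring_scope.
Import HBNNSimple.

(** Two obstacles shape the proof. The hypotheses speak only of events: a conditional expectation is
    tested on sets of [sigma_vec w], independence is a product rule for probabilities, and the noise
    is known through its law. Equality of two such set functions gives orthogonality to the sampling
    error, the product rule for independent variables, and the passage from [P] to the Gaussian
    density. The second obstacle is regularity. No bound on the true gradients is assumed; they are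
    square-integrable because each is an almost surely bounded sample gradient minus a
    square-integrable error. They must also be measurable for the sigma-algebra of the model
    although they need not be continuous. Generated sigma-algebras therefore appear as types
    ([g_sigma_algebraType]), so that general measurability lemmas apply to them directly. *)

(** * Integrable and square-integrable real functions *)

Lemma integrable_addr {d} {T : measurableType d} {R : realType}
    {mu : {measure set T -> \bar R}} (X Y : T -> R) :
  mu.-integrable [set: T] (EFin \o X) -> mu.-integrable [set: T] (EFin \o Y) ->
  mu.-integrable [set: T] (EFin \o (fun x => X x + Y x)).
Proof. by move=> iX iY; exact: (integrableD measurableT iX iY). Qed.

Lemma integrable_subr {d} {T : measurableType d} {R : realType}
    {mu : {measure set T -> \bar R}} (X Y : T -> R) :
  mu.-integrable [set: T] (EFin \o X) -> mu.-integrable [set: T] (EFin \o Y) ->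
  mu.-integrable [set: T] (EFin \o (fun x => X x - Y x)).
Proof. by move=> iX iY; exact: (integrableB measurableT iX iY). Qed.

Lemma integrable_mulrl {d} {T : measurableType d} {R : realType}
    {mu : {measure set T -> \bar R}} (k : R) (X : T -> R) :
  mu.-integrable [set: T] (EFin \o X) ->
  mu.-integrable [set: T] (EFin \o (fun x => k * X x)).
Proof. by move=> iX; exact: (integrableZl measurableT k iX). Qed.

Lemma integrable_sumr {d} {T : measurableType d} {R : realType}
    {mu : {measure set T -> \bar R}} {I : Type} (s : seq I) (Q : pred I)
    (X : I -> T -> R) :
  (forall i, Q i -> mu.-integrable [set: T] (EFin \o X i)) ->
  mu.-integrable [set: T] (EFin \o (fun x => \sum_(i <- s | Q i) X i x)).
Proof.
move=> iX.
rewrite (_ : EFin \o _ = fun x => (\sum_(i <- s | Q i) (X i x)%:E)%E); last first.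
  by apply/funext => x; rewrite /= sumEFin.
by apply: (integrable_sum measurableT) => i Qi; exact: iX.
Qed.

Lemma Rintegral_sum {d} {T : measurableType d} {R : realType}
    {mu : {measure set T -> \bar R}} {I : Type} (s : seq I) (Q : pred I)
    (X : I -> T -> R) :
  (forall i, Q i -> mu.-integrable [set: T] (EFin \o X i)) ->
  \int[mu]_x (\sum_(i <- s | Q i) X i x) = \sum_(i <- s | Q i) \int[mu]_x X i x.
Proof.
move=> iX; elim: s => [|a s IH].
  by under eq_Rintegral do rewrite big_nil; rewrite big_nil /Rintegral integral0.
rewrite big_cons -IH; case: ifPn => Qa.
  under eq_Rintegral do rewrite big_cons Qa.
  by rewrite RintegralD//; [exact: iX|exact: integrable_sumr].
by apply: eq_Rintegral => x _; rewrite big_cons (negbTE Qa).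
Qed.

Lemma integrable_bounded_mul {d} {T : measurableType d} {R : realType}
    {mu : {measure set T -> \bar R}} (b X : T -> R) :
  measurable_fun [set: T] b -> (forall x, `|b x| <= 1) ->
  mu.-integrable [set: T] (EFin \o X) ->
  mu.-integrable [set: T] (EFin \o (fun x => b x * X x)).
Proof.
move=> mb b1 iX.
have mX : measurable_fun [set: T] X.
  by apply/measurable_EFinP; exact: measurable_int iX.
apply: (le_integrable measurableT _ _ iX).
  by apply/measurable_EFinP; exact: (measurable_funM mb mX).
by move=> x _; rewrite /= lee_fin normrM ler_piMl.
Qed.

(** Measurability is a separate conjunct because that of the square does not give that of [X]. The
    class is closed under linear combinations and products of two members are integrable, which
    settles the integrability of every cross term of a round. *)
Definition sqintegrable {d} {T : measurableType d} {R : realType}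
    (mu : {measure set T -> \bar R}) (X : T -> R) : Prop :=
  measurable_fun [set: T] X /\
  mu.-integrable [set: T] (EFin \o (fun x => X x ^+ 2)).

Lemma le_sqintegrable {d} {T : measurableType d} {R : realType}
    {mu : {measure set T -> \bar R}} (X Y : T -> R) :
  measurable_fun [set: T] X -> (forall x, `|X x| <= `|Y x|) ->
  sqintegrable mu Y -> sqintegrable mu X.
Proof.
move=> mX XY [mY iY]; split => //; apply: (le_integrable measurableT _ _ iY).
  by apply/measurable_EFinP; exact: measurable_funX.
by move=> x _; rewrite /= lee_fin !normrX lerXn2r ?nnegrE.
Qed.

Lemma sqintegrableD {d} {T : measurableType d} {R : realType}
    {mu : {measure set T -> \bar R}} (X Y : T -> R) :
  sqintegrable mu X -> sqintegrable mu Y ->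
  sqintegrable mu (fun x => X x + Y x).
Proof.
move=> [mX iX] [mY iY]; have mD := measurable_funD mX mY; split => //.
have := integrable_addr _ _ (integrable_mulrl 2 _ iX) (integrable_mulrl 2 _ iY).
apply: (le_integrable measurableT).
  by apply/measurable_EFinP; exact: (measurable_funX 2 mD).
move=> x _; rewrite /= lee_fin ger0_norm ?sqr_ge0//.
rewrite ger0_norm ?addr_ge0 ?(mulr_ge0 _ (sqr_ge0 _))//.
by have := sqr_ge0 (X x - Y x); nra.
Qed.

Lemma sqintegrableZ {d} {T : measurableType d} {R : realType}
    {mu : {measure set T -> \bar R}} (k : R) (X : T -> R) :
  sqintegrable mu X -> sqintegrable mu (fun x => k * X x).
Proof.
move=> [mX iX]; split; first exact: measurable_funM.
rewrite (_ : (fun x => (k * X x) ^+ 2) = (fun x => k ^+ 2 * X x ^+ 2)).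
  exact: integrable_mulrl.
by apply/funext => x; rewrite exprMn.
Qed.

Lemma sqintegrableB {d} {T : measurableType d} {R : realType}
    {mu : {measure set T -> \bar R}} (X Y : T -> R) :
  sqintegrable mu X -> sqintegrable mu Y ->
  sqintegrable mu (fun x => X x - Y x).
Proof.
move=> sX sY; rewrite (_ : (fun x => _) = fun x => X x + (-1) * Y x).
  by apply: sqintegrableD => //; exact: sqintegrableZ.
by apply/funext => x; rewrite mulN1r.
Qed.

Lemma sqintegrable_sum {d} {T : measurableType d} {R : realType}
    {mu : {measure set T -> \bar R}} {I : Type} (s : seq I) (Q : pred I)
    (X : I -> T -> R) :
  (forall i, Q i -> sqintegrable mu (X i)) ->
  sqintegrable mu (fun x => \sum_(i <- s | Q i) X i x).
Proof.
move=> sX; elim: s => [|a s IH].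
  rewrite (_ : (fun x => _) = cst 0); last by apply/funext => x; rewrite big_nil.
  split => //; rewrite (_ : EFin \o _ = cst 0%E); first exact: integrable0.
  by apply/funext => x /=; rewrite expr0n.
case: (boolP (Q a)) => Qa.
  rewrite (_ : (fun x => _) = fun x => X a x + \sum_(i <- s | Q i) X i x).
    by apply: sqintegrableD => //; exact: sX.
  by apply/funext => x; rewrite big_cons Qa.
rewrite (_ : (fun x => _) = fun x => \sum_(i <- s | Q i) X i x)//.
by apply/funext => x; rewrite big_cons (negbTE Qa).
Qed.

Lemma sqintegrable_mul {d} {T : measurableType d} {R : realType}
    {mu : {measure set T -> \bar R}} (X Y : T -> R) :
  sqintegrable mu X -> sqintegrable mu Y ->
  mu.-integrable [set: T] (EFin \o (fun x => X x * Y x)).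
Proof.
move=> [mX iX] [mY iY]; have := integrable_addr _ _ iX iY.
apply: (le_integrable measurableT).
  by apply/measurable_EFinP; exact: (measurable_funM mX mY).
move=> x _; rewrite /= lee_fin [leRHS]ger0_norm ?addr_ge0 ?sqr_ge0//.
rewrite ler_norml; apply/andP; split.
  by have := sqr_ge0 (X x + Y x); have := sqr_ge0 (X x); have := sqr_ge0 (Y x); nra.
by have := sqr_ge0 (X x - Y x); have := sqr_ge0 (X x); have := sqr_ge0 (Y x); nra.
Qed.

Lemma sqintegrable_cst {d} {T : measurableType d} {R : realType}
    {P : probability T R} (k : R) : sqintegrable P (cst k).
Proof.
split; first exact: measurable_cst.
exact: (finite_measure_integrable_cst P (k ^+ 2) measurableT).
Qed.

Lemma sqintegrable_integrable {d} {T : measurableType d} {R : realType}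
    {P : probability T R} (X : T -> R) :
  sqintegrable P X -> P.-integrable [set: T] (EFin \o X).
Proof.
move=> sX; have := sqintegrable_mul _ _ sX (sqintegrable_cst 1).
by under [X in _.-integrable _ (_ \o X)]eq_fun do rewrite mulr1.
Qed.

Lemma ae_bounded_sqintegrable {d} {T : measurableType d} {R : realType}
    {P : probability T R} (X : T -> R) (K : R) :
  measurable_fun [set: T] X -> {ae P, forall x, `|X x| <= K} ->
  sqintegrable P X.
Proof.
move=> mX XK; split => //; apply/integrableP; split.
  by apply/measurable_EFinP; exact: measurable_funX.
have /integrableP[_] := finite_measure_integrable_cst P (K ^+ 2) measurableT.
apply: le_lt_trans; apply: ae_ge0_le_integral => //=.
  by apply/measurable_EFinP; apply: measurableT_comp => //; exact: measurable_funX.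
apply: filterS XK => x XK _; rewrite lee_fin !normrX lerXn2r ?nnegrE//.
exact: le_trans XK (ler_norm _).
Qed.

(** * Integrals of products: orthogonality and independence *)

(** Monotone convergence along simple functions increasing to [f]. The point of the right-hand side
    is that [Y], [X] and [mu] enter it only through the integrals of [X] over preimages under
    [Y]. *)
Lemma ge0_integral_comp_weight {d} {T : measurableType d} {R : realType}
    (mu : {measure set T -> \bar R}) (Y X : T -> R) (f : R -> R)
    (mf : measurable_fun setT (EFin \o f)) :
  measurable_fun [set: T] Y -> measurable_fun [set: T] X ->
  (forall x, 0 <= X x) -> (forall y, 0 <= f y) ->
  (\int[mu]_x (f (Y x) * X x)%:E =
   limn (fun n => \sum_(y \in range (nnsfun_approx measurableT mf n))
     y%:E * \int[mu]_(x in Y @^-1` (nnsfun_approx measurableT mf n @^-1` [set y]))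
              (X x)%:E))%E.
Proof.
move=> mY mX X0 f0; set h := nnsfun_approx measurableT mf.
have mhY n : measurable_fun [set: T] (h n \o Y).
  exact: measurableT_comp.
have hcvg y : (EFin \o h n) y @[n --> \oo] --> (f y)%:E.
  by apply: (@cvg_nnsfun_approx _ _ _ _ measurableT _ mf) => // x _; rewrite lee_fin.
transitivity (limn (fun n => (\int[mu]_x (h n (Y x) * X x)%:E)%E)).
  rewrite -monotone_convergence//=.
  - apply: eq_integral => x _; apply/esym/cvg_lim => //.
    rewrite EFinM; under eq_fun do rewrite EFinM.
    by apply: cvgeZr => //; exact: hcvg.
  - move=> n; apply/measurable_EFinP; exact: (measurable_funM (mhY n) mX).
  - by move=> n x _; rewrite lee_fin mulr_ge0.
  - move=> x _ a b ab; rewrite lee_fin ler_wpM2r//.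
    by move: ab => /(@nd_nnsfun_approx _ _ _ _ measurableT _ mf)/lefP.
congr (limn _); apply/funext => n.
have mA y : measurable (Y @^-1` (h n @^-1` [set y])).
  by rewrite -[X in measurable X]setTI; exact: mY.
transitivity (\int[mu]_x \sum_(y \in range (h n))
    (y * \1_(h n @^-1` [set y]) (Y x) * X x)%:E)%E.
  apply: eq_integral => x _.
  rewrite fsumEFin// -mulr_fsuml.
  by rewrite -(fimfunE (h n) (Y x)).
rewrite ge0_integral_fsum//=; last 2 first.
- move=> y; apply/measurable_EFinP; apply: measurable_funM => //.
  apply: measurable_funM => //; apply: measurableT_comp => //.
- move=> y x _; rewrite lee_fin mulr_ge0//.
  by have := nnfun_muleindic_ge0 (h n) y (Y x); rewrite -EFinM lee_fin.
apply: eq_fsbigr => y; rewrite inE => -[x _ <-].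
have hx : 0 <= h n x by [].
rewrite [in RHS]integral_mkcond -ge0_integralZl//; last 2 first.
- apply/(measurable_restrictT _ _).1 => //.
  by apply: measurable_funTS; exact/measurable_EFinP.
- by move=> t _; apply: erestrict_ge0 => u _; rewrite lee_fin.
apply: eq_integral => t _; rewrite patchE indicE.
have -> : (Y t \in h n @^-1` [set h n x]) =
          (t \in Y @^-1` (h n @^-1` [set h n x])) by [].
by case: (t \in _); rewrite ?mulr1 ?mulr0 ?mul0r ?mule0.
Qed.

(** Two spaces are allowed because of its two uses: the positive and negative parts of one function
    on the same space, and the weight 1 under [P] against a density under Lebesgue measure. *)
Lemma eq_ge0_integral_comp_weight {d1 d2} {T1 : measurableType d1}
    {T2 : measurableType d2} {R : realType} (mu1 : {measure set T1 -> \bar R})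
    (mu2 : {measure set T2 -> \bar R}) (Y1 X1 : T1 -> R) (Y2 X2 : T2 -> R)
    (f : R -> R) :
  measurable_fun [set: T1] Y1 -> measurable_fun [set: T1] X1 ->
  measurable_fun [set: T2] Y2 -> measurable_fun [set: T2] X2 ->
  (forall x, 0 <= X1 x) -> (forall x, 0 <= X2 x) ->
  measurable_fun setT f -> (forall y, 0 <= f y) ->
  (forall B, measurable B ->
     (\int[mu1]_(x in Y1 @^-1` B) (X1 x)%:E =
      \int[mu2]_(x in Y2 @^-1` B) (X2 x)%:E)%E) ->
  (\int[mu1]_x (f (Y1 x) * X1 x)%:E = \int[mu2]_x (f (Y2 x) * X2 x)%:E)%E.
Proof.
move=> mY1 mX1 mY2 mX2 X10 X20 mf f0 XE.
have mf' : measurable_fun setT (EFin \o f) by exact/measurable_EFinP.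
rewrite !(ge0_integral_comp_weight _ _ _ _ mf')//.
congr (limn _); apply/funext => n; apply: eq_fsbigr => y _.
by rewrite XE.
Qed.

(** A conditional mean zero given [Y] kills the product with [Y], which may be unbounded. The
    hypothesis says that [X^\+] and [X^\-] have the same integrals over all preimages under [Y];
    hence they agree against every nonnegative function of [Y], in particular against both parts of
    [Y]. *)
Lemma Rintegral_mul_eq0 {d} {T : measurableType d} {R : realType}
    (mu : {measure set T -> \bar R}) (X Y : T -> R) :
  mu.-integrable [set: T] (EFin \o X) -> measurable_fun [set: T] Y ->
  mu.-integrable [set: T] (EFin \o (Y \* X)) ->
  (forall B, measurable B -> \int[mu]_(x in Y @^-1` B) X x = 0) ->
  \int[mu]_x (Y x * X x) = 0.
Proof.
move=> iX mY iYX X0.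
have mX : measurable_fun [set: T] X.
  by apply/measurable_EFinP; exact: measurable_int iX.
have posneg (Z : T -> R) x : Z x = Z^\+ x - Z^\- x.
  by rewrite -{1}(funrposBneg Z).
have mpos : measurable_fun setT (fun y : R => Num.max y 0).
  exact: measurable_maxr.
have mneg : measurable_fun setT (fun y : R => Num.max (- y) 0).
  by apply: measurable_maxr => //; exact: measurable_funN.
have mXp := measurable_funrpos mX.
have mXn := measurable_funrneg mX.
have XBE B : measurable B ->
    (\int[mu]_(x in Y @^-1` B) (X^\+ x)%:E =
     \int[mu]_(x in Y @^-1` B) (X^\- x)%:E)%E.
  move=> mB; have mYB : measurable (Y @^-1` B).
    by rewrite -[X in measurable X]setTI; exact: mY.
  have iXB : mu.-integrable (Y @^-1` B) (EFin \o X) by exact: integrableS iX.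
  have iXp : mu.-integrable (Y @^-1` B) (EFin \o X^\+).
    exact: integrable_funrpos.
  have iXn : mu.-integrable (Y @^-1` B) (EFin \o X^\-).
    exact: integrable_funrneg.
  have := X0 B mB.
  under eq_Rintegral do rewrite posneg.
  rewrite RintegralB// => /eqP; rewrite subr_eq0 => /eqP XE.
  rewrite -[LHS]fineK ?integrable_fin_num// -[RHS]fineK ?integrable_fin_num//.
  by congr EFin.
(* Here [f] stands for the positive or the negative part of a real number. The bound by the absolute
   value lets [Y \* X] dominate every integrand that occurs. *)
have key (f : R -> R) : measurable_fun setT f -> (forall y : R, 0 <= f y <= `|y|) ->
    mu.-integrable [set: T] (EFin \o (fun x => f (Y x) * X x)) /\
    \int[mu]_x (f (Y x) * X x) = 0.
  move=> mf f0.
  have mfY : measurable_fun [set: T] (f \o Y) by exact: measurableT_comp.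
  have dom (Z : T -> R) : measurable_fun [set: T] Z ->
      (forall x, `|Z x| <= `|X x|) ->
      mu.-integrable [set: T] (EFin \o (fun x => f (Y x) * Z x)).
    move=> mZ ZX; apply: le_integrable iYX => //.
      by apply/measurable_EFinP; exact: (measurable_funM mfY mZ).
    move=> x _; rewrite /= lee_fin !normrM ler_pM//.
    by have /andP[? ?] := f0 (Y x); rewrite ger0_norm.
  have iX1 : mu.-integrable [set: T] (EFin \o (fun x => f (Y x) * X^\+ x)).
    apply: dom => // x; rewrite /funrpos ger0_norm ?le_max ?lexx ?orbT//.
    by rewrite ge_max ler_norm normr_ge0.
  have iX2 : mu.-integrable [set: T] (EFin \o (fun x => f (Y x) * X^\- x)).
    apply: dom => // x; rewrite /funrneg ger0_norm ?le_max ?lexx ?orbT//.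
    by rewrite ge_max -normrN ler_norm normr_ge0.
  split; first exact: dom.
  rewrite (_ : \int[mu]_x _ =
      \int[mu]_x (f (Y x) * X^\+ x - f (Y x) * X^\- x)); last first.
    by apply: eq_Rintegral => x _; rewrite -mulrBr -posneg.
  have f00 y : 0 <= f y by have /andP[] := f0 y.
  rewrite RintegralB// /Rintegral (eq_ge0_integral_comp_weight _ _ _ _ _ _ _
    mY mXp mY mXn (funrpos_ge0 X) (funrneg_ge0 X) mf f00 XBE).
  by rewrite subrr.
have [|i1 e1] := key _ mpos.
  by move=> y; rewrite le_max lexx orbT/= ge_max ler_norm normr_ge0.
have [|i2 e2] := key _ mneg.
  by move=> y; rewrite le_max lexx orbT/= ge_max -normrN ler_norm normr_ge0.
rewrite (_ : \int[mu]_x _ = \int[mu]_x (Num.max (Y x) 0 * X x -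
                                        Num.max (- Y x) 0 * X x)).
  by rewrite RintegralB// e1 e2 subrr.
apply: eq_Rintegral => x _; rewrite -mulrBl; congr (_ * _).
by rewrite [in LHS](posneg Y).
Qed.

(** Two applications of [Rintegral_mul_eq0]. First the centred indicator [W] of an event of [Y] is
    tested against [X], so that the integral of [X] over this event is its probability times the
    mean of [X]. Then the centred [X] is tested against [Y]. *)
Lemma Rintegral_mul_indep {d} {T : measurableType d} {R : realType}
    (P : probability T R) (X Y : T -> R) :
  P.-integrable [set: T] (EFin \o X) -> P.-integrable [set: T] (EFin \o Y) ->
  P.-integrable [set: T] (EFin \o (Y \* X)) ->
  (forall B C, measurable B -> measurable C ->
     P (X @^-1` B `&` Y @^-1` C) = (P (X @^-1` B) * P (Y @^-1` C))%E) ->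
  \int[P]_x (Y x * X x) = (\int[P]_x Y x) * (\int[P]_x X x).
Proof.
move=> iX iY iYX XY.
have mX : measurable_fun [set: T] X.
  by apply/measurable_EFinP; exact: measurable_int iX.
have mY : measurable_fun [set: T] Y.
  by apply/measurable_EFinP; exact: measurable_int iY.
have icst A r : measurable A -> P.-integrable A (EFin \o cst r).
  by move=> mA; exact: finite_measure_integrable_cst.
pose e := \int[P]_x X x.
have onY C : measurable C ->
    \int[P]_(x in Y @^-1` C) X x = fine (P (Y @^-1` C)) * e.
  move=> mC; set A := Y @^-1` C; have mA : measurable A.
    by rewrite /A -[X in measurable X]setTI; exact: mY.
  pose W := fun x => \1_A x - fine (P A).
  have iW : P.-integrable [set: T] (EFin \o W).
    by apply: integrable_subr (icst _ _ measurableT); exact: integrable_indic.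
  have mXA : measurable_fun [set: T] (fun x => X x * \1_A x).
    by apply: measurable_funM => //; exact: measurable_indic.
  have iXA : P.-integrable [set: T] (EFin \o (fun x => X x * \1_A x)).
    apply: le_integrable iX => //; first exact/measurable_EFinP.
    move=> x _; rewrite /= lee_fin normrM ler_piMr//.
    by rewrite indicE; case: (_ \in _); rewrite ?normr1 ?normr0.
  have iXc : P.-integrable [set: T] (EFin \o (fun x => X x * fine (P A))).
    exact: (integrableZr measurableT _ iX).
  have : \int[P]_x (X x * W x) = 0.
    apply: Rintegral_mul_eq0 => //.
      rewrite (_ : X \* W = fun x => X x * \1_A x - X x * fine (P A)).
        exact: integrable_subr.
      by apply/funext => x; rewrite -mulrBr.
    move=> B mB; have mXB : measurable (X @^-1` B).
      by rewrite -[X in measurable X]setTI; exact: mX.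
    rewrite RintegralB//; last 2 first.
      by apply: (integrableS measurableT) => //; exact: integrable_indic.
      exact: icst.
    rewrite Rintegral_cst// /Rintegral integral_indic// [A `&` _]setIC.
    suff : fine (P (X @^-1` B `&` A)) - fine (P A) * fine (P (X @^-1` B)) = 0.
      by [].
    by rewrite XY// fineM ?fin_num_measure// mulrC subrr.
  have -> : \int[P]_x (X x * W x) = \int[P]_x (X x * \1_A x - X x * fine (P A)).
    by apply: eq_Rintegral => x _; rewrite mulrBr.
  rewrite RintegralB// RintegralZr// => /eqP; rewrite subr_eq0 => /eqP.
  rewrite mulrC => <-; rewrite Rintegral_mkcond; apply: eq_Rintegral => x _.
  by rewrite patchE indicE; case: (_ \in _); rewrite ?mulr1 ?mulr0.
have iXe : P.-integrable [set: T] (EFin \o (fun x => X x - e)).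
  exact: integrable_subr iX (icst _ _ measurableT).
have iYe : P.-integrable [set: T] (EFin \o (fun x => Y x * e)).
  exact: (integrableZr measurableT _ iY).
have : \int[P]_x (Y x * (X x - e)) = 0.
  apply: Rintegral_mul_eq0 => //.
    rewrite (_ : _ \* _ = fun x => Y x * X x - Y x * e).
      exact: integrable_subr.
    by apply/funext => x; rewrite -mulrBr.
  move=> C mC; have mA : measurable (Y @^-1` C).
    by rewrite -[X in measurable X]setTI; exact: mY.
  rewrite RintegralB//; last 2 first.
    exact: (integrableS measurableT).
    exact: icst.
  by rewrite onY// Rintegral_cst// mulrC subrr.
have -> : \int[P]_x (Y x * (X x - e)) = \int[P]_x (Y x * X x - Y x * e).
  by apply: eq_Rintegral => x _; rewrite mulrBr.
by rewrite RintegralB// RintegralZr// => /eqP; rewrite subr_eq0 => /eqP.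
Qed.

(** * First and second moments of the centred Gaussian *)

(** The boundary term at infinity of the primitive that yields the variance. *)
Lemma cvg_id_mul_normal_pdf {R : realType} (s : R) : s != 0 ->
  x * normal_pdf 0 s x @[x --> +oo] --> (0 : R).
Proof.
move=> s0; have s20 : 0 < s ^+ 2 by rewrite exprn_even_gt0.
apply: (@squeeze_cvgr _ _ _ _ (fun=> 0) (fun x => normal_peak s * expR (- x))).
- near=> x.
  have x0 : 0 <= x by near: x; apply: nbhs_pinfty_ge; rewrite num_real.
  rewrite mulr_ge0 ?normal_pdf_ge0//= normal_pdfE// mulrCA.
  rewrite ler_wpM2l ?normal_peak_ge0// /normal_fun subr0.
  have xe : x <= expR x by apply: le_trans (expR_ge1Dx x); rewrite lerDr.
  apply: (le_trans (ler_wpM2r (expR_ge0 _) xe)).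
  rewrite -expRD ler_expR -mulr_natr mulNr.
  (* From [4 s^2] on, the exponent [x^2 / (2 s^2)] is at least [2 x]: one [x] pays for the bound of
     the factor [x] by [expR x], the other leaves [expR (- x)]. *)
  have xs : s ^+ 2 * 4 <= x by near: x; apply: nbhs_pinfty_ge; rewrite num_real.
  suff : 2 * x <= x ^+ 2 / (s ^+ 2 * 2) by lra.
  have s22 : 0 < s ^+ 2 * 2 by rewrite mulr_gt0.
  rewrite ler_pdivlMr//; have := ler_wpM2l x0 xs.
  lra.
- exact: cvg_cst.
- rewrite -[X in _ --> X](mulr0 (normal_peak s)).
  by apply: cvgM; [exact: cvg_cst|exact: cvgr_expR].
Unshelve. all: end_near. Qed.

Lemma is_derive_normal_pdf {R : realType} (s x : R) : s != 0 ->
  is_derive x 1 (normal_pdf 0 s) (- x / s ^+ 2 * normal_pdf 0 s x).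
Proof.
move=> s0; rewrite !normal_pdfE// /normal_fun.
under eq_fun do rewrite subr0; rewrite subr0.
have s20 : s ^+ 2 != 0 by rewrite expf_neq0.
apply: is_derive_eq.
rewrite /GRing.scale/=.
by field.
Qed.

Lemma integral_expRN {R : realType} :
  (\int[@lebesgue_measure R]_(x in `[0%R, +oo[) (expR (- x))%:E = 1)%E.
Proof.
rewrite (@ge0_continuous_FTC2y _ _ (fun x => - expR (- x)) _ 0).
- by rewrite oppr0 expR0 EFinN oppeK add0e.
- by move=> x _; exact: expR_ge0.
- apply: continuous_subspaceT => x.
  by apply: continuous_comp; [exact: continuousN|exact: continuous_expR].
- by rewrite -oppr0; apply: cvgN; exact: cvgr_expR.
- by [].
- apply: cvg_at_right_filter; apply: cvgN.
  by apply: continuous_comp; [exact: continuousN|exact: continuous_expR].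
- move=> x _; rewrite derive1E.
  have dE : is_derive x (1 : R) (fun x : R => - expR (- x)) (expR (- x)).
    by apply: is_derive_eq; rewrite /GRing.scale/= mulrN1 opprK.
  exact: (@derive_val _ _ _ _ _ _ _ dE).
Qed.

Lemma integral_normal_pdf_half {R : realType} (s : R) : s != 0 ->
  (\int[@lebesgue_measure R]_(x in `[0%R, +oo[) (normal_pdf 0 s x)%:E =
   (2^-1)%:E)%E.
Proof.
move=> s0; have := integral_normal_pdf 0 s.
rewrite ge0_symfun_integralT//=; last 3 first.
- by move=> x; exact: normal_pdf_ge0.
- exact: continuous_normal_pdf.
- by move=> x; rewrite /= !normal_pdfE// /normal_fun !subr0 sqrrN.
rewrite -set_itvcy => /(congr1 (fun z => (2^-1)%:E * z)%E).
by rewrite muleA -EFinM mulVf// mul1e mule1.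
Qed.

Lemma integral_sqr_normal_pdf {R : realType} (s : R) : s != 0 ->
  (\int[@lebesgue_measure R]_x (x ^+ 2 * normal_pdf 0 s x)%:E =
   (s ^+ 2)%:E)%E.
Proof.
move=> s0; have s20 : 0 < s ^+ 2 by rewrite exprn_even_gt0.
have cp : continuous (normal_pdf 0 s) by exact: continuous_normal_pdf.
have cN : continuous (fun x : R => expR (- x)).
  by move=> x; apply: continuous_comp; [exact: continuousN|exact: continuous_expR].
have cX : continuous (fun x : R => x ^+ 2) by exact: exprn_continuous.
have p0 x : 0 <= normal_pdf 0 s x by exact: normal_pdf_ge0.
(* The constant comes from completing the square: [(x - s^2)^2 >= 0] gives
   [- x^2 / (2 s^2) <= - x + s^2 / 2], so [c expR (- x)] dominates [s^2] times the density. *)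
pose c := s ^+ 2 * normal_peak s * expR (s ^+ 2 / 2).
have c0 : 0 <= c.
  by rewrite mulr_ge0 ?expR_ge0// mulr_ge0 ?normal_peak_ge0// ltW.
have pc x : s ^+ 2 * normal_pdf 0 s x <= c * expR (- x).
  rewrite normal_pdfE// /c -(mulrA _ (expR _) (expR _)) -(mulrA (s ^+ 2)).
  apply: ler_wpM2l; first exact: ltW.
  apply: ler_wpM2l; first exact: normal_peak_ge0.
  rewrite /normal_fun subr0 -expRD ler_expR -mulr_natr mulNr.
  have : 0 <= (x - s ^+ 2) ^+ 2 / (s ^+ 2 * 2).
    by rewrite mulr_ge0 ?sqr_ge0// invr_ge0 mulr_ge0// ltW.
  have -> : (x - s ^+ 2) ^+ 2 / (s ^+ 2 * 2) =
            x ^+ 2 / (s ^+ 2 * 2) - x + s ^+ 2 / 2.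
    by field; rewrite s0.
  lra.
(* [(x^2 - s^2) p] is the derivative of [- s^2 x p] but changes sign; adding
   [c exp(-x)] makes it nonnegative, as [ge0_continuous_FTC2y] requires. *)
have IF : (\int[@lebesgue_measure R]_(x in `[0%R, +oo[)
    (x ^+ 2 * normal_pdf 0 s x - s ^+ 2 * normal_pdf 0 s x + c * expR (- x))%:E
    = c%:E)%E.
  (* A primitive with value [- c] at 0 and limit 0 at infinity, hence the total [c]. *)
  pose F x := - s ^+ 2 * (x * normal_pdf 0 s x) - c * expR (- x).
  have dF x : is_derive x (1 : R) F
     (x ^+ 2 * normal_pdf 0 s x - s ^+ 2 * normal_pdf 0 s x + c * expR (- x)).
    have dp := is_derive_normal_pdf s x s0.
    apply: is_derive_eq; rewrite /GRing.scale/=.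
    by field; rewrite s0.
  have cF x : {for x, continuous F}.
    by apply/differentiable_continuous/derivable1_diffP.
  rewrite (@ge0_continuous_FTC2y _ _ F _ 0).
  - by rewrite /F mul0r mulr0 oppr0 expR0 mulr1 sub0r -EFinB sub0r opprK.
  - move=> x _; have := pc x; have := p0 x; have := sqr_ge0 x.
    by move=> x2 p; have := mulr_ge0 x2 p; lra.
  - apply: continuous_subspaceT => x; apply: cvgD.
      apply: cvgB; apply: cvgM => //.
      - exact: cX.
      - exact: cp.
      - exact: cvg_cst.
      - exact: cp.
    by apply: cvgM; [exact: cvg_cst|exact: cN].
  - rewrite (_ : 0 = - s ^+ 2 * 0 - c * 0); last by rewrite !mulr0 subr0.
    apply: cvgB; apply: cvgM; do ?exact: cvg_cst.
      exact: cvg_id_mul_normal_pdf.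
    exact: cvgr_expR.
  - by [].
  - exact/cvg_at_right_filter/cF.
  - by move=> x _; rewrite derive1E; exact: (@derive_val _ _ _ _ _ _ _ (dF x)).
have mp : measurable_fun [set: R] (normal_pdf 0 s) by exact: measurable_normal_pdf.
have mN : measurable_fun [set: R] (fun x : R => expR (- x)).
  exact: continuous_measurable_fun.
have mX : measurable_fun [set: R] (fun x : R => x ^+ 2 * normal_pdf 0 s x).
  by apply: measurable_funM => //; exact: continuous_measurable_fun.
have half : (\int[@lebesgue_measure R]_(x in `[0%R, +oo[)
    (x ^+ 2 * normal_pdf 0 s x)%:E = (s ^+ 2 / 2)%:E)%E.
  (* One integral is computed twice: by splitting off the exponential, and from [IF] by adding back
     [s^2] times half the mass of the density. Only nonnegative integrands are split, and the finite
     [c] cancels at the end. *)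
  have E1 : (\int[@lebesgue_measure R]_(x in `[0%R, +oo[)
      (x ^+ 2 * normal_pdf 0 s x + c * expR (- x))%:E =
      \int[@lebesgue_measure R]_(x in `[0%R, +oo[)
      (x ^+ 2 * normal_pdf 0 s x)%:E + c%:E)%E.
    under eq_integral do rewrite EFinD.
    rewrite ge0_integralD//=.
    - under [X in (_ + X)%E]eq_integral do rewrite EFinM.
      rewrite ge0_integralZl//=.
      + by rewrite integral_expRN mule1.
      + by apply/measurable_EFinP; exact: measurable_funTS.
    - by move=> x _; rewrite lee_fin mulr_ge0 ?sqr_ge0.
    - by apply/measurable_EFinP; exact: measurable_funTS.
    - by move=> x _; rewrite lee_fin mulr_ge0 ?expR_ge0.
    - by apply/measurable_EFinP; apply: measurable_funTS; exact: measurable_funM.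
  have E2 : (\int[@lebesgue_measure R]_(x in `[0%R, +oo[)
      (x ^+ 2 * normal_pdf 0 s x + c * expR (- x))%:E =
      c%:E + (s ^+ 2 / 2)%:E)%E.
    rewrite -IF EFinM -(integral_normal_pdf_half s s0).
    rewrite -ge0_integralZl//=; last 3 first.
    - by apply/measurable_EFinP; exact: measurable_funTS.
    - by move=> x _; rewrite lee_fin.
    - by rewrite lee_fin ltW.
    rewrite -ge0_integralD//=.
    - by apply: eq_integral => x _; rewrite -EFinD; congr EFin; ring.
    - move=> x _; rewrite lee_fin.
      have := pc x; have := mulr_ge0 (sqr_ge0 x) (p0 x); lra.
    - apply/measurable_EFinP; apply: measurable_funTS; apply: measurable_funD.
        by apply: measurable_funB => //; exact: measurable_funM.
      exact: measurable_funM.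
    - by move=> x _; rewrite lee_fin mulr_ge0// ltW.
    - by apply/measurable_EFinP; apply: measurable_funTS; exact: measurable_funM.
  move: E2; rewrite E1 addeC => /(congr1 (fun z => z - c%:E)%E).
  by rewrite addeAC subee// add0e addeAC subee// add0e.
rewrite ge0_symfun_integralT//=.
- by rewrite -set_itvcy half -EFinM mulrC divfK.
- by move=> x; rewrite mulr_ge0 ?sqr_ge0.
- by move=> x; apply: cvgM; [exact: cX|exact: cp].
- by move=> x; rewrite /= !normal_pdfE// /normal_fun !subr0 sqrrN.
Qed.

(** The reflection of the line preserves the density. Comparing the two halves as nonnegative
    integrals avoids any integrability question for the odd integrand itself. *)
Lemma integral_oddneg_normal_pdf {R : realType} (s : R) : s != 0 ->
  (\int[@lebesgue_measure R]_x (Num.max x 0 * normal_pdf 0 s x)%:E =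
   \int[@lebesgue_measure R]_x (Num.max (- x) 0 * normal_pdf 0 s x)%:E)%E.
Proof.
move=> s0.
have cp : continuous (normal_pdf 0 s) by exact: continuous_normal_pdf.
have pN x : normal_pdf 0 s (- x) = normal_pdf 0 s x.
  by rewrite !normal_pdfE// /normal_fun !subr0 sqrrN.
pose G (x : R) := - x * normal_pdf 0 s x.
have cG : continuous G by move=> x; apply: cvgM; [exact: continuousN|exact: cp].
have -> : (\int[@lebesgue_measure R]_x (Num.max (- x) 0 * normal_pdf 0 s x)%:E =
    \int[@lebesgue_measure R]_(x in `]-oo, (- 0)%R]) (G x)%:E)%E.
  rewrite [RHS]integral_mkcond; apply: eq_integral => x _; rewrite patchE.
  case: ifPn; rewrite oppr0 ?inE ?notin_setE/= in_itv/=.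
    by move=> x0; rewrite max_l// oppr_ge0.
  by move=> /negP; rewrite -ltNge => x0; rewrite max_r ?mul0r// oppr_le0 ltW.
rewrite ge0_integration_by_substitutionNy; last 2 first.
- exact: continuous_subspaceT.
- move=> x; rewrite oppr0 in_itv/= => x0.
  by rewrite mulr_ge0 ?normal_pdf_ge0// oppr_ge0 ltW.
rewrite [RHS]integral_mkcond; apply: eq_integral => x _; rewrite patchE.
case: ifPn; rewrite ?inE ?notin_setE/= in_itv/= andbT.
  by move=> x0; rewrite /G opprK pN max_l.
by move=> /negP; rewrite -ltNge => x0; rewrite max_r ?mul0r// ltW.
Qed.

(** [normal_prob] of a set is by definition the integral of the density over it, so the assumption
    on the law is the set-function equality of [eq_ge0_integral_comp_weight], with weight 1 for [X]
    and the density as weight for the identity. *)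
Lemma ge0_integral_gaussian_rv {d} {T : measurableType d} {R : realType}
    (P : probability T R) (v : R) (X : T -> R) (f : R -> R) :
  0 < v -> gaussian_rv P v X -> measurable_fun setT f -> (forall y, 0 <= f y) ->
  (\int[P]_x (f (X x))%:E =
   \int[@lebesgue_measure R]_y (f y * normal_pdf 0 (Num.sqrt v) y)%:E)%E.
Proof.
move=> v0 [mX XE] mf f0.
transitivity (\int[P]_x (f (X x) * 1)%:E)%E.
  by apply: eq_integral => x _; rewrite mulr1.
apply: (eq_ge0_integral_comp_weight P (@lebesgue_measure R) X (fun=> 1)
  id (normal_pdf 0 (Num.sqrt v)) f) => //.
- exact: measurable_normal_pdf.
- by move=> y; exact: normal_pdf_ge0.
- move=> B mB; rewrite preimage_id -/(normal_prob 0 (Num.sqrt v) B) -XE//.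
  rewrite integral_cst ?mul1e//.
  by rewrite -[X in measurable X]setTI; exact: mX.
Qed.

Lemma gaussian_rv_sqintegrable {d} {T : measurableType d} {R : realType}
    (P : probability T R) (v : R) (X : T -> R) :
  0 < v -> gaussian_rv P v X -> sqintegrable P X.
Proof.
move=> v0 gX; have [mX _] := gX; split => //; apply/integrableP; split.
  by apply/measurable_EFinP; exact: measurable_funX.
under eq_integral do rewrite /= ger0_norm ?sqr_ge0//.
rewrite (ge0_integral_gaussian_rv P v X (fun y => y ^+ 2))//.
- by rewrite integral_sqr_normal_pdf ?ltry// gt_eqF// sqrtr_gt0.
- by move=> y; exact: sqr_ge0.
Qed.

Lemma gaussian_rv_sqr {d} {T : measurableType d} {R : realType}
    (P : probability T R) (v : R) (X : T -> R) :
  0 < v -> gaussian_rv P v X -> \int[P]_x (X x ^+ 2) = v.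
Proof.
move=> v0 gX; rewrite /Rintegral (ge0_integral_gaussian_rv P v X (fun y => y ^+ 2))//.
- by rewrite integral_sqr_normal_pdf ?gt_eqF ?sqrtr_gt0//= sqr_sqrtr// ltW.
- by move=> y; exact: sqr_ge0.
Qed.

Lemma gaussian_rv_mean {d} {T : measurableType d} {R : realType}
    (P : probability T R) (v : R) (X : T -> R) :
  0 < v -> gaussian_rv P v X -> \int[P]_x X x = 0.
Proof.
move=> v0 gX; have [mX _] := gX.
have iX : P.-integrable [set: T] (EFin \o X).
  by apply: sqintegrable_integrable; exact: gaussian_rv_sqintegrable gX.
have iXp : P.-integrable [set: T] (EFin \o X^\+) by exact: integrable_funrpos.
have iXn : P.-integrable [set: T] (EFin \o X^\-) by exact: integrable_funrneg.
rewrite -(funrposBneg X) (_ : \int[P]_x _ = \int[P]_x (X^\+ x - X^\- x))//.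
rewrite RintegralB//; apply/eqP; rewrite subr_eq0; apply/eqP; congr fine.
rewrite (ge0_integral_gaussian_rv P v X (fun y => Num.max y 0))//; last 2 first.
- exact: measurable_maxr.
- by move=> y; rewrite le_max lexx orbT.
rewrite (ge0_integral_gaussian_rv P v X (fun y => Num.max (- y) 0))//; last 2 first.
- by apply: measurable_maxr => //; exact: measurable_funN.
- by move=> y; rewrite le_max lexx orbT.
by apply: integral_oddneg_normal_pdf; rewrite gt_eqF// sqrtr_gt0.
Qed.

(** * Measurability along a random model *)

(* Rounding the coordinates of [w] down to multiples of [1 / n.+1] leaves
   countably many values, so [phi \o w] is a limit of countably valued
   measurable functions. *)
Lemma measurable_continuous_rV {d} {T : measurableType d} {R : realType}
    {k : nat} (w : T -> 'rV[R]_k) (phi : 'rV[R]_k -> R) :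
  (forall j, measurable_fun [set: T] (fun o => w o ord0 j)) ->
  continuous phi -> measurable_fun [set: T] (phi \o w).
Proof.
move=> mw cphi.
pose z n (o : T) : {ffun 'I_k -> int} :=
  [ffun j => Num.floor (w o ord0 j * n.+1%:R)].
pose grid n (y : {ffun 'I_k -> int}) : 'rV[R]_k := \row_j ((y j)%:~R / n.+1%:R).
apply: (@measurable_fun_cvg _ _ _ _ (fun n o => phi (grid n (z n o)))).
  move=> n _ A mA; rewrite setTI.
  have -> : (fun o => phi (grid n (z n o))) @^-1` A =
      \bigcup_(y : {ffun 'I_k -> int})
        ([set o | z n o = y] `&` [set _ | A (phi (grid n y))]).
    apply/seteqP; split => [t At|t [y _ []]] /=; last by move=> <-.
    by exists (z n t).
  apply: countable_bigcupT_measurable; first exact: countableP.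
  move=> y; apply: measurableI; last first.
    have [?|?] := pselect (A (phi (grid n y))).
      by rewrite (_ : [set _ | _] = setT) //; apply/seteqP; split.
    by rewrite (_ : [set _ | _] = set0) //; apply/seteqP; split.
  have -> : [set o | z n o = y] = \bigcap_(j in [set: 'I_k])
      ((fun o => w o ord0 j * n.+1%:R) @^-1` `[(y j)%:~R, (y j + 1)%:~R[).
    apply/seteqP; split => [t + j _|t oy].
      rewrite /= => <-.
      by rewrite in_itv/= ffunE floor_itv.
    apply/ffunP => j; rewrite ffunE; apply: floor_def.
    by have := oy j I; rewrite /= in_itv.
  apply: fin_bigcap_measurable => // j _.
  have mwn : measurable_fun [set: T] (fun o => w o ord0 j * n.+1%:R).
    exact: measurable_funM.
  by rewrite -[X in measurable X]setTI; exact: mwn.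
move=> o _; apply: (@cvg_comp _ _ _ (fun n => grid n (z n o)) phi); last exact: cphi.
apply/cvg_ballP => e e0; near=> n; split => // i j; rewrite ord1.
rewrite /ball/= /grid mxE ffunE.
have n0 : 0 < n.+1%:R :> R by [].
have /andP[f1 f2] := floor_itv (w o ord0 j * n.+1%:R).
rewrite -[in X in X - _](mulfK (lt0r_neq0 n0) (w o ord0 j)) -mulrBl normrM.
rewrite [X in _ * X]ger0_norm ?invr_ge0//.
apply: (@le_lt_trans _ _ (n.+1%:R^-1)).
  rewrite ler_piMl// ler_norml; move: f2; rewrite intrD mulr1z => f2.
  by apply/andP; split; lra.
by near: n; exact: (near_infty_natSinv_lt (PosNum e0)).
Unshelve. all: end_near. Qed.

(** The gradient of a differentiable function need not be continuous, but it is the limit of the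
    difference quotients with step [1 / n.+1], which are continuous functions of the model. With [T]
    taken to be the sample space under a generated sigma-algebra, this yields measurability with
    respect to [w] alone. *)
Lemma measurable_gradient {d} {T : measurableType d} {R : realType} {k : nat}
    (w : T -> 'rV[R]_k) (f : 'rV[R]_k -> R) (j : 'I_k) :
  (forall j, measurable_fun [set: T] (fun o => w o ord0 j)) ->
  (forall x, differentiable (f : _ -> R^o) x) ->
  measurable_fun [set: T] (fun o => gradient f (w o) ord0 j).
Proof.
move=> mw df; pose e := delta_mx ord0 j : 'rV[R]_k.
have cf : continuous f.
  by move=> x; exact: (differentiable_continuous (df x)).
pose D n (o : T) : R := n.+1%:R * (f (n.+1%:R^-1 *: e + w o) - f (w o)).
apply: (@measurable_fun_cvg _ _ _ _ D) => [n|o _].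
  apply: measurable_funM => //; apply: measurable_funB.
    apply: (@measurable_continuous_rV _ _ _ _
      (fun o => n.+1%:R^-1 *: e + w o) f) => // i.
    rewrite (_ : (fun o => _) =
      fun o => (n.+1%:R^-1 *: e) ord0 i + w o ord0 i).
      by apply: measurable_funD.
    by apply/funext => o; rewrite mxE.
  exact: measurable_continuous_rV.
rewrite /gradient mxE.
have der : (fun h : R => h^-1 * (f (h *: e + w o) - f (w o))) h @[h --> 0^'] -->
    'D_e f (w o).
  exact: (@diff_derivable _ _ _ (f : _ -> R^o) (w o) e (df (w o))).
have u0 n : n.+1%:R^-1 != 0 :> R by rewrite invr_eq0 pnatr_eq0.
have := (cvgr_dnbhsP _ _ _).1 der (fun n => n.+1%:R^-1) (conj u0 cvg_harmonic).
by under eq_fun do rewrite invrK.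
Qed.

(** * Pathwise identities and the descent inequality *)

Lemma enorm_sqrE {R : realType} {d : nat} (v : 'rV[R]_d) :
  enorm v ^+ 2 = \sum_(j < d) v ord0 j ^+ 2.
Proof.
rewrite /enorm /dotv sqr_sqrtr.
  by apply: eq_bigr => j _; rewrite expr2.
by apply: sumr_ge0 => j _; rewrite -expr2 sqr_ge0.
Qed.

Lemma gradient_global_loss {R : realType} {d M : nat}
    (f : 'I_M -> 'rV[R]_d -> R) (x : 'rV[R]_d) (j : 'I_d) :
  (forall m y, differentiable (f m : _ -> R^o) y) ->
  gradient (global_loss f) x ord0 j =
    M%:R^-1 * \sum_(m < M) gradient (f m) x ord0 j.
Proof.
move=> df; rewrite /gradient mxE; under eq_bigr do rewrite mxE.
set e := delta_mx ord0 j.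
have de m : derivable (f m : _ -> R^o) x e by exact: diff_derivable.
have -> : global_loss f = M%:R^-1 \*: (\sum_(m < M) (f m : 'rV[R]_d -> R^o)).
  by apply/funext => y; rewrite /global_loss /= fct_sumE.
rewrite deriveZ ?derive_sum//; exact: derivable_sum.
Qed.

Lemma smooth_global_loss {R : realType} {d M : nat} (L : R)
    (f : 'I_M -> 'rV[R]_d -> R) :
  (0 < M)%N -> (forall m y, differentiable (f m : _ -> R^o) y) ->
  (forall m, smooth L (f m)) -> smooth L (global_loss f).
Proof.
move=> M0 df fL x y.
have M0R : M%:R != 0 :> R by rewrite pnatr_eq0 -lt0n.
have -> : dotv (gradient (global_loss f) y) (x - y) =
    M%:R^-1 * \sum_(m < M) dotv (gradient (f m) y) (x - y).
  rewrite /dotv exchange_big mulr_sumr; apply: eq_bigr => j _.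
  by rewrite gradient_global_loss// -mulrA mulr_suml.
have -> : L / 2 * enorm (x - y) ^+ 2 =
    M%:R^-1 * \sum_(m < M) L / 2 * enorm (x - y) ^+ 2.
  by rewrite sumr_const card_ord -[X in _ = _ * X]mulr_natl mulKf.
rewrite /global_loss -!mulrDr -!big_split/= ler_wpM2l ?invr_ge0//.
by apply: ler_sum => m _; exact: fL.
Qed.

(* The channel coefficients cancel against the precoders. *)
Lemma server_updateE {R : realType} {d M : nat} (lambda eta : R)
    (h : 'I_M -> R[i]) (g : 'I_M -> 'rV[R]_d) (noise : 'rV[R[i]]_d)
    (x : 'rV[R]_d) (j : 'I_d) :
  0 < eta -> (forall m, h m != 0) ->
  server_update lambda eta x (received eta h g noise) ord0 j =
  x ord0 j - lambda * (M%:R^-1 * (\sum_(m < M) g m ord0 j) +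
                       complex.Re (noise ord0 j) / Num.sqrt eta).
Proof.
move=> eta0 h0; have s0 : Num.sqrt eta != 0 by rewrite gt_eqF// sqrtr_gt0.
rewrite /server_update mxE; congr (_ + _).
rewrite mxE; congr (- _); rewrite mxE mxE.
have hp m : h m * precoder M eta (h m) = real_complex R (Num.sqrt eta / M%:R).
  rewrite /precoder invfM mulrCA [X in _ * X]mulrCA mulfV// mulr1.
  by rewrite rmorphM fmorphV rmorph_nat.
have -> : complex.Re (received eta h g noise ord0 j) =
    Num.sqrt eta * (M%:R^-1 * (\sum_(m < M) g m ord0 j)) +
    complex.Re (noise ord0 j).
  rewrite /received mxE summxE raddfD/=; congr (_ + _).
  rewrite raddf_sum mulrA mulr_sumr; apply: eq_bigr => m _.
  rewrite mxE hp mxE -[RHS]/(complex.Re (real_complex R _)).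
  by rewrite -rmorphM.
by set a := M%:R^-1 * _; field; rewrite s0.
Qed.

(** Written in coordinate sums because all expectations are later taken one coordinate at a time;
    [u] will be the noisy mean gradient. *)
Lemma smooth_step {R : realType} {d : nat} (L lambda : R) (f : 'rV[R]_d -> R)
    (x x' u : 'rV[R]_d) :
  smooth L f -> (forall j, x' ord0 j = x ord0 j - lambda * u ord0 j) ->
  f x' <= f x + (- lambda * (\sum_(j < d) gradient f x ord0 j * u ord0 j)
                 + L * lambda ^+ 2 / 2 * \sum_(j < d) u ord0 j ^+ 2).
Proof.
move=> fL xE; apply: (le_trans (fL x' x)); rewrite -addrA lerD2l.
rewrite enorm_sqrE /dotv !mulr_sumr -!big_split/=.
by apply: ler_sum => j _; rewrite !mxE xE; lra.
Qed.

(** * Batch sampling and the second moment of a device gradient *)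

(** Measurability for the generated sigma-algebras is what places the preimages of Borel sets among
    the events to which the product rule applies. *)
Lemma Rintegral_mul_indep_sigma {d} {Omega : measurableType d} {R : realType}
    (P : probability Omega R) (SX SY : set (set Omega)) (X Y : Omega -> R) :
  independent_sigma P <<s SX >> <<s SY >> ->
  measurable_fun [set: g_sigma_algebraType SX]
    (X : g_sigma_algebraType SX -> R) ->
  measurable_fun [set: g_sigma_algebraType SY]
    (Y : g_sigma_algebraType SY -> R) ->
  P.-integrable [set: Omega] (EFin \o X) ->
  P.-integrable [set: Omega] (EFin \o Y) ->
  P.-integrable [set: Omega] (EFin \o (fun o => X o * Y o)) ->
  \int[P]_o (X o * Y o) = (\int[P]_o X o) * (\int[P]_o Y o).
Proof.
move=> XY mX mY iX iY iXY; rewrite [RHS]mulrC.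
rewrite (_ : \int[P]_o (X o * Y o) = \int[P]_o (Y o * X o)); last first.
  by apply: eq_Rintegral => o _; rewrite mulrC.
apply: Rintegral_mul_indep => //.
  rewrite (_ : Y \* X = fun o => X o * Y o)//.
  by apply/funext => o; rewrite mulrC.
move=> B C mB mC; apply: XY.
  by rewrite -[X @^-1` B]setTI; exact: (mX measurableT B mB).
by rewrite -[Y @^-1` C]setTI; exact: (mY measurableT C mC).
Qed.

Lemma measurable_sigma_fin {d} {Omega : measurableType d} {R : realType}
    {I : finType} (X : Omega -> I) (S : set (set Omega)) (phi : I -> R) :
  sigma_fin X `<=` <<s S >> ->
  measurable_fun [set: g_sigma_algebraType S]
    ((fun o => phi (X o)) : g_sigma_algebraType S -> R).
Proof.
move=> XS _ A mA; rewrite setTI; apply: XS.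
by exists (phi @^-1` A) => //; rewrite setTI.
Qed.

Lemma measurable_sigma_vec {d} {Omega : measurableType d} {R : realType}
    {k : nat} (X : Omega -> 'rV[R]_k) (S : set (set Omega)) (j : 'I_k) :
  sigma_vec X `<=` <<s S >> ->
  measurable_fun [set: g_sigma_algebraType S]
    ((fun o => X o ord0 j) : g_sigma_algebraType S -> R).
Proof.
move=> XS _ A mA; rewrite setTI; apply: XS; apply: sub_gen_smallest.
by exists j => //; exists A => //; rewrite setTI.
Qed.

(** The gap is half the double sum of [b k * b i * (x k - x i) ^+ 2]. With batch indicators as
    weights, the double sum keeps in each term a function of the batch times the square of a single
    sample; with unit weights it gives convexity over the devices. *)
Lemma sqr_sum_weighted {R : realFieldType} {I : finType} (b x : I -> R) :
  (forall i, 0 <= b i) ->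
  (\sum_i b i * x i) ^+ 2 <= \sum_i \sum_k b k * b i * x i ^+ 2.
Proof.
move=> b0.
have E1 : (\sum_i b i * x i) ^+ 2 = \sum_i \sum_k b k * b i * (x k * x i).
  rewrite expr2 mulr_suml; apply: eq_bigr => i _; rewrite mulr_sumr.
  by apply: eq_bigr => k _; ring.
have E2 : \sum_i \sum_k b k * b i * x k ^+ 2 = \sum_i \sum_k b k * b i * x i ^+ 2.
  rewrite exchange_big; apply: eq_bigr => i _; apply: eq_bigr => k _.
  by rewrite [b i * _]mulrC.
suff : 0 <= \sum_i \sum_k b k * b i * x i ^+ 2 +
            \sum_i \sum_k b k * b i * x k ^+ 2 - (\sum_i b i * x i) ^+ 2 *+ 2.
  by rewrite E2 mulr2n; lra.
rewrite E1 mulr2n -!big_split -sumrB /=; apply: sumr_ge0 => i _.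
rewrite -!big_split -sumrB /=; apply: sumr_ge0 => k _.
rewrite [X in 0 <= X](_ : _ = b k * b i * (x k - x i) ^+ 2); last by ring.
by rewrite mulr_ge0 ?sqr_ge0// mulr_ge0.
Qed.

(** The diagonal term is [q], since an indicator equals its square; each other term is [q * q] by
    independence applied to a pair of indices. Counting [n] such terms instead of [n - 1] gives the
    bound. *)
Lemma poisson_sampling_pair_sum {d} {Omega : measurableType d} {R : realType}
    (P : probability Omega R) (n : nat) (q : R)
    (batch : Omega -> {set 'I_n}) (i : 'I_n) :
  poisson_sampling P q batch ->
  \sum_k \int[P]_o ((k \in batch o)%:R * (i \in batch o)%:R) <=
    q * (1 + n%:R * q).
Proof.
move=> [mb bq bi].
have q0 : 0 <= q by rewrite -lee_fin -(bq i).
have E k : \int[P]_o ((k \in batch o)%:R * (i \in batch o)%:R) =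
    fine (P ([set o | k \in batch o] `&` [set o | i \in batch o])).
  rewrite -[X in fine (P X)]setIT -integral_indic//; last exact: measurableI.
  apply: eq_Rintegral => o _.
  rewrite indicI /= !indicE !mem_setE//.
rewrite (bigD1 i)//= E setIid bq /=.
rewrite mulrDr mulr1 lerD2l.
apply: (@le_trans _ _ (\sum_(k < n | k != i) q * q)).
  apply: ler_sum => k ki; rewrite E.
  have := bi [set k; i]%SET (fun m => [set o | m \in batch o]) (fun _ _ => erefl).
  rewrite big_setU1/= ?big_set1 ?inE// !bq -EFinM.
  have -> : \bigcap_(m in [set` [set k; i]%SET]) [set o | m \in batch o] =
      [set o | k \in batch o] `&` [set o | i \in batch o].
    apply/seteqP; split => [s bo|s [ks is_] m] /=.
      by split; apply: bo; rewrite /= !inE eqxx ?orbT.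
    by rewrite !inE => /orP[] /eqP ->.
  by move=> ->.
apply: (@le_trans _ _ (\sum_(k < n) q * q)).
  by rewrite [leRHS](bigD1 i)//= lerDr mulr_ge0.
by rewrite sumr_const card_ord -mulr_natl; lra.
Qed.

Lemma measurable_batch {d} {Omega : measurableType d} {R : realType}
    (P : probability Omega R) (n : nat) (q : R)
    (batch : Omega -> {set 'I_n}) (i : 'I_n) :
  poisson_sampling P q batch ->
  measurable_fun [set: Omega] (fun o => (i \in batch o)%:R : R).
Proof.
move=> [mb _ _]; rewrite (_ : (fun o => _) = \1_[set o | i \in batch o]).
  exact: measurable_indic.
by apply/funext => o; rewrite indicE mem_setE.
Qed.

Lemma sqintegrable_batch_mul {d} {Omega : measurableType d} {R : realType}
    (P : probability Omega R) (n : nat) (q : R)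
    (batch : Omega -> {set 'I_n}) (i : 'I_n) (Y : Omega -> R) :
  poisson_sampling P q batch -> sqintegrable P Y ->
  sqintegrable P (fun o => (i \in batch o)%:R * Y o).
Proof.
move=> bP sY; have mb := measurable_batch P n q batch i bP.
apply: (le_sqintegrable _ _ _ _ sY).
  by case: sY => mY _; exact: measurable_funM.
by move=> o; case: (_ \in _); rewrite ?mul1r// mul0r normr0.
Qed.

Lemma Rintegral_batch_mul {d} {Omega : measurableType d} {R : realType}
    (P : probability Omega R) (n : nat) (q : R) (batch : Omega -> {set 'I_n})
    (SX SY : set (set Omega)) (i : 'I_n) (Y : Omega -> R) :
  poisson_sampling P q batch -> sigma_fin batch `<=` <<s SX >> ->
  independent_sigma P <<s SX >> <<s SY >> ->
  measurable_fun [set: g_sigma_algebraType SY]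
    (Y : g_sigma_algebraType SY -> R) ->
  P.-integrable [set: Omega] (EFin \o Y) ->
  \int[P]_o ((i \in batch o)%:R * Y o) = q * \int[P]_o Y o.
Proof.
move=> bP bS SXY mY iY; have mb := measurable_batch P n q batch i bP.
have [msb bq _] := bP.
have b1 o : `|(i \in batch o)%:R : R| <= 1.
  by case: (_ \in _); rewrite ?normr1 ?normr0.
have Eb : \int[P]_o (i \in batch o)%:R = q :> R.
  rewrite -[RHS]/(fine q%:E) -(bq i) -[[set o | _]]setIT -integral_indic//.
  by apply: eq_Rintegral => o _; rewrite indicE mem_setE.
rewrite (Rintegral_mul_indep_sigma P SX SY) ?Eb//.
- exact: (measurable_sigma_fin batch SX (fun A => (i \in A)%:R) bS).
- have := integrable_bounded_mul _ _ mb b1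
    (finite_measure_integrable_cst P 1 measurableT).
  by under [X in _.-integrable _ (_ \o X)]eq_fun do rewrite mulr1.
- exact: integrable_bounded_mul.
Qed.

(** After [sqr_sum_weighted] the product of two batch indicators is independent of the one squared
    sample beside it, so each expectation factors and no product of two different samples ever
    arises. *)
Lemma Rintegral_device_gradient_sqr {d} {Omega : measurableType d}
    {R : realType} (P : probability Omega R) (n B : nat)
    (batch : Omega -> {set 'I_n}) (SX SY : set (set Omega))
    (g : 'I_n -> Omega -> R) :
  (1 <= B <= n)%N -> poisson_sampling P (B%:R / n%:R) batch ->
  sigma_fin batch `<=` <<s SX >> ->
  independent_sigma P <<s SX >> <<s SY >> ->
  (forall i, measurable_fun [set: g_sigma_algebraType SY]
    (g i : g_sigma_algebraType SY -> R)) ->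
  (forall i, sqintegrable P (g i)) ->
  \int[P]_o (B%:R^-1 * \sum_i (i \in batch o)%:R * g i o) ^+ 2 <=
    2 / n%:R * \sum_i \int[P]_o g i o ^+ 2.
Proof.
move=> /andP[B1 Bn] bP bS SXY mg sg; set q : R := B%:R / n%:R.
pose b i o : R := (i \in batch o)%:R.
have B0 : 0 < B%:R :> R by rewrite ltr0n.
have n0 : 0 < n%:R :> R by rewrite ltr0n (leq_trans B1).
have mb i : measurable_fun [set: Omega] (b i) by exact: measurable_batch bP.
have b1 i o : `|b i o| <= 1 by rewrite /b; case: (_ \in _); rewrite ?normr1 ?normr0.
have mbb k i : measurable_fun [set: Omega] (fun o => b k o * b i o).
  exact: measurable_funM.
have bb1 k i o : `|b k o * b i o| <= 1.
  by rewrite normrM mulr_ile1.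
have ibbg k i : P.-integrable [set: Omega]
    (EFin \o (fun o => b k o * b i o * g i o ^+ 2)).
  by apply: integrable_bounded_mul => //; case: (sg i).
have ibb k i : P.-integrable [set: Omega] (EFin \o (fun o => b k o * b i o)).
  have := integrable_bounded_mul _ _ (mbb k i) (bb1 k i)
    (finite_measure_integrable_cst P 1 measurableT).
  by under [X in _.-integrable _ (_ \o X)]eq_fun do rewrite mulr1.
apply: (@le_trans _ _ (\int[P]_o (B%:R^-1 ^+ 2 *
    \sum_i \sum_k b k o * b i o * g i o ^+ 2))).
  apply: le_Rintegral => //.
  - have : sqintegrable P (fun o => B%:R^-1 * \sum_i b i o * g i o).
      apply: sqintegrableZ; apply: sqintegrable_sum => i _.
      exact: sqintegrable_batch_mul bP _.
    by case.
  - apply: integrable_mulrl; apply: integrable_sumr => i _.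
    by apply: integrable_sumr => k _.
  - move=> o _; rewrite exprMn ler_wpM2l ?sqr_ge0//.
    by apply: sqr_sum_weighted => i; rewrite ler0n.
rewrite RintegralZl//; last first.
  by apply: integrable_sumr => i _; apply: integrable_sumr => k _.
rewrite Rintegral_sum; last by move=> i _; apply: integrable_sumr => k _.
have sumE i : \int[P]_o (\sum_k b k o * b i o * g i o ^+ 2) <=
    q * (1 + n%:R * q) * \int[P]_o (g i o ^+ 2).
  rewrite Rintegral_sum//.
  under eq_bigr => k _.
    rewrite (Rintegral_mul_indep_sigma P SX SY (fun o => b k o * b i o))//.
    - over.
    - exact: (measurable_sigma_fin batch SX
        (fun A => (k \in A)%:R * (i \in A)%:R) bS).
    - exact: (measurable_funX 2 (mg i)).
    - by case: (sg i).
  rewrite -mulr_suml ler_wpM2r//.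
    by apply: Rintegral_ge0 => o _; exact: sqr_ge0.
  exact: poisson_sampling_pair_sum.
apply: (@le_trans _ _ (B%:R^-1 ^+ 2 *
    \sum_i q * (1 + n%:R * q) * \int[P]_o (g i o ^+ 2))).
  by rewrite ler_wpM2l ?sqr_ge0//; apply: ler_sum.
rewrite -mulr_sumr mulrA ler_wpM2r//.
  by apply: sumr_ge0 => i _; apply: Rintegral_ge0 => o _; exact: sqr_ge0.
(* With [q = B / n] one has [q (1 + n q) / B^2 = ((1 + B) / B) / n], and [B >= 1] bounds
   [(1 + B) / B] by 2. *)
rewrite /q [X in X <= _](_ : _ = (1 + B%:R) / B%:R / n%:R); last first.
  by field; rewrite !gt_eqF.
rewrite ler_wpM2r ?invr_ge0 ?ler0n// ler_pdivrMr//.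
have : 1 <= B%:R :> R by rewrite ler1n.
lra.
Qed.

(** * Moments of sample gradients, similarity, and unbiased device gradients *)

(** The difference agrees almost everywhere with its positive part, whose integral is nonnegative.
    The variance bound holds only almost surely, which calls for this form. *)
Lemma ae_le_Rintegral {d} {T : measurableType d} {R : realType}
    (mu : {measure set T -> \bar R}) (X Y : T -> R) :
  mu.-integrable [set: T] (EFin \o X) -> mu.-integrable [set: T] (EFin \o Y) ->
  {ae mu, forall x, X x <= Y x} -> \int[mu]_x X x <= \int[mu]_x Y x.
Proof.
move=> iX iY XY.
have iD : mu.-integrable [set: T] (EFin \o (Y \- X)) by exact: integrable_subr.
rewrite -subr_ge0 -RintegralB//.
have -> : \int[mu]_x (Y x - X x) = \int[mu]_x (Y \- X)^\+ x.
  congr fine; apply: ae_eq_integral => //.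
  - exact: measurable_int iD.
  - exact: measurable_int (integrable_funrpos measurableT iD).
  - apply: filterS XY => x XY _; congr EFin; rewrite /funrpos max_l//.
    by rewrite subr_ge0.
by apply: Rintegral_ge0 => x _; exact: funrpos_ge0.
Qed.

(** [is_cond_exp] includes the integrability of the squared norm of the error, which dominates each
    squared coordinate. *)
Lemma unbiased_sqintegrable {d} {Omega : measurableType d} {R : realType}
    {k : nat} (P : probability Omega R) (A1 A2 : R)
    (w grad g : Omega -> 'rV[R]_k) (j : 'I_k) :
  unbiased_bounded_variance P A1 A2 w grad g ->
  sqintegrable P (fun o => (g o - grad o) ord0 j).
Proof.
move=> [zj [V [iz _ _ _] _]].
have mz i : measurable_fun [set: Omega] (fun o => (g o - grad o) ord0 i).
  by apply/measurable_EFinP; case: (zj i) => /measurable_int.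
split; first exact: mz.
apply: (le_integrable measurableT _ _ iz).
  by apply/measurable_EFinP; exact: (measurable_funX 2 (mz j)).
move=> o _; rewrite /= lee_fin !ger0_norm ?sqr_ge0//.
by rewrite enorm_sqrE (bigD1 j)//= lerDl sumr_ge0// => i _; exact: sqr_ge0.
Qed.

Lemma unbiased_Rintegral_mul {d} {Omega : measurableType d} {R : realType}
    {k : nat} (P : probability Omega R) (A1 A2 : R)
    (w grad g : Omega -> 'rV[R]_k) (j : 'I_k) (Y : Omega -> R) :
  unbiased_bounded_variance P A1 A2 w grad g ->
  measurable_fun [set: g_sigma_algebraType
      (\bigcup_(i in [set: 'I_k]) sigma_rv (fun o => w o ord0 i))]
    (Y : g_sigma_algebraType _ -> R) ->
  sqintegrable P Y ->
  \int[P]_o (Y o * (g o - grad o) ord0 j) = 0.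
Proof.
move=> ub mY sY; have sz := unbiased_sqintegrable P A1 A2 w grad g j ub.
have [zj _] := ub; have [iz _ _ z0] := zj j.
apply: Rintegral_mul_eq0 => //; first by case: sY.
  exact: sqintegrable_mul sY sz.
move=> B mB; have wB : sigma_vec w (Y @^-1` B).
  by rewrite -[Y @^-1` B]setTI; exact: (mY measurableT B mB).
by have := z0 _ wB; rewrite /Rintegral => <-; rewrite integral0.
Qed.

(** Pythagoras: [grad] is measurable for the sigma-algebra of [w], hence orthogonal to the error in
    each coordinate. The sum over coordinates is essential, as the variance bound concerns the whole
    norm. *)
Lemma unbiased_second_moment {d} {Omega : measurableType d} {R : realType}
    {k : nat} (P : probability Omega R) (A1 A2 : R)
    (w grad g : Omega -> 'rV[R]_k) :
  unbiased_bounded_variance P A1 A2 w grad g ->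
  (forall j, measurable_fun [set: g_sigma_algebraType
      (\bigcup_(i in [set: 'I_k]) sigma_rv (fun o => w o ord0 i))]
    ((fun o => grad o ord0 j) : g_sigma_algebraType _ -> R)) ->
  (forall j, sqintegrable P (fun o => grad o ord0 j)) ->
  \sum_(j < k) \int[P]_o (g o ord0 j ^+ 2) <=
    (A1 + 1) * (\sum_(j < k) \int[P]_o (grad o ord0 j ^+ 2)) + A2.
Proof.
move=> ub mG sG; have sz j := unbiased_sqintegrable P A1 A2 w grad g j ub.
have oG j := unbiased_Rintegral_mul P A1 A2 w grad g j _ ub (mG j) (sG j).
have iG j : P.-integrable [set: Omega] (EFin \o (fun o => grad o ord0 j ^+ 2)).
  by case: (sG j).
have iz j : P.-integrable [set: Omega]
    (EFin \o (fun o => (g o - grad o) ord0 j ^+ 2)).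
  by case: (sz j).
have iGz j : P.-integrable [set: Omega]
    (EFin \o (fun o => grad o ord0 j * (g o - grad o) ord0 j)).
  exact: sqintegrable_mul.
have gE j : \int[P]_o (g o ord0 j ^+ 2) = \int[P]_o (grad o ord0 j ^+ 2) +
    \int[P]_o ((g o - grad o) ord0 j ^+ 2).
  rewrite (_ : \int[P]_o (g o ord0 j ^+ 2) = \int[P]_o (grad o ord0 j ^+ 2 +
      (2 * (grad o ord0 j * (g o - grad o) ord0 j) +
       (g o - grad o) ord0 j ^+ 2))); last first.
    by apply: eq_Rintegral => o _; rewrite !mxE; ring.
  rewrite RintegralD//; last first.
    by apply: integrable_addr => //; exact: integrable_mulrl.
  rewrite RintegralD//; last exact: integrable_mulrl.
  by rewrite RintegralZl// oG mulr0 add0r.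
under eq_bigr do rewrite gE; rewrite big_split/= mulrDl mul1r.
suff : \sum_(j < k) \int[P]_o ((g o - grad o) ord0 j ^+ 2) <=
    A1 * (\sum_(j < k) \int[P]_o (grad o ord0 j ^+ 2)) + A2 by lra.
have [_ [V [ie iV _ Ve] Vle]] := ub.
have iGs : P.-integrable [set: Omega] (EFin \o (fun o => enorm (grad o) ^+ 2)).
  rewrite (_ : (fun o => _) = fun o => \sum_(j < k) grad o ord0 j ^+ 2).
    by apply: integrable_sumr => j _.
  by apply/funext => o; rewrite enorm_sqrE.
have iA2 : P.-integrable [set: Omega] (EFin \o (fun=> A2)).
  exact: (finite_measure_integrable_cst P A2 measurableT).
have -> : \sum_(j < k) \int[P]_o ((g o - grad o) ord0 j ^+ 2) = \int[P]_o V o.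
  rewrite -Rintegral_sum// /Rintegral; congr fine.
  (* Testing the version [V] on the whole space turns the conditional second moment into the
     unconditional one. *)
  have wT : sigma_vec w [set: Omega].
    exact: (@measurableT _ (g_sigma_algebraType (\bigcup_(i in [set: 'I_k])
      sigma_rv (fun o => w o ord0 i)))).
  by rewrite (Ve _ wT); apply: eq_integral => o _; rewrite enorm_sqrE.
have -> : A1 * (\sum_(j < k) \int[P]_o (grad o ord0 j ^+ 2)) + A2 =
    \int[P]_o (A1 * enorm (grad o) ^+ 2 + A2).
  rewrite RintegralD//; last exact: integrable_mulrl.
  rewrite RintegralZl// Rintegral_cst//; congr (_ * _ + _); last first.
    rewrite -[LHS]mulr1; congr (_ * _).
    exact: (esym (congr1 fine (probability_setT P))).
  by rewrite -Rintegral_sum//; apply: eq_Rintegral => o _; rewrite enorm_sqrE.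
apply: ae_le_Rintegral => //; apply: integrable_addr => //.
exact: integrable_mulrl.
Qed.

Lemma device_gradientE {R : realType} {d n : nat} (B : nat)
    (batch : {set 'I_n}) (g : 'I_n -> 'rV[R]_d) (j : 'I_d) :
  device_gradient B batch g ord0 j =
  B%:R^-1 * \sum_i (i \in batch)%:R * g i ord0 j.
Proof.
rewrite /device_gradient mxE summxE big_mkcond; congr (_ * _).
by apply: eq_bigr => i _; case: (_ \in _); rewrite ?mul1r ?mul0r.
Qed.

Lemma sqr_mean_le {R : realFieldType} {M : nat} (a : 'I_M -> R) :
  (0 < M)%N ->
  (M%:R^-1 * \sum_m a m) ^+ 2 <= M%:R^-1 * \sum_m a m ^+ 2.
Proof.
move=> M0; have M0R : 0 < M%:R :> R by rewrite ltr0n.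
have := sqr_sum_weighted (fun=> 1) a (fun=> ler01).
under eq_bigr do rewrite mul1r.
under [X in _ <= X]eq_bigr => m _ do
  rewrite sumr_const card_ord !mul1r -[X in X *+ _]mulr1 -mulrnAr mulrC.
rewrite -mulr_sumr => H.
rewrite exprMn expr2 -mulrA ler_wpM2l ?invr_ge0 ?ler0n//.
by rewrite ler_pdivrMl.
Qed.

(** Since the global gradient is the mean of the local ones, the mean squared deviation equals the
    mean of the squared norms minus the squared norm of the mean. This identity gives [C1 + 1]
    without the factor 2 of a triangle-type estimate. *)
Lemma bounded_similarity_mean {R : realType} {d M : nat} (C1 C2 : R)
    (f : 'I_M -> 'rV[R]_d -> R) (x : 'rV[R]_d) :
  (0 < M)%N -> (forall m y, differentiable (f m : _ -> R^o) y) ->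
  bounded_similarity C1 C2 f ->
  M%:R^-1 * \sum_(m < M) enorm (gradient (f m) x) ^+ 2 <=
    (C1 + 1) * enorm (gradient (global_loss f) x) ^+ 2 + C2.
Proof.
move=> M0 df fC; have M0R : M%:R != 0 :> R by rewrite pnatr_eq0 -lt0n.
rewrite mulrDl mul1r addrAC -lerBlDr; apply: le_trans (fC x).
rewrite le_eqVlt; apply/orP; left; apply/eqP.
rewrite (eq_bigr _ (fun m _ => enorm_sqrE (gradient (f m) x))).
rewrite (eq_bigr _ (fun m _ => enorm_sqrE
  (gradient (f m) x - gradient (global_loss f) x))).
rewrite enorm_sqrE exchange_big [in RHS]exchange_big !mulr_sumr -sumrB.
apply: eq_bigr => j _; set F := gradient (global_loss f) x ord0 j.
have FE : \sum_m gradient (f m) x ord0 j = M%:R * F.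
  by rewrite /F gradient_global_loss// mulrA divff// mul1r.
have dE m : (gradient (f m) x - gradient (global_loss f) x) ord0 j =
    gradient (f m) x ord0 j - F.
  by rewrite mxE; congr (_ + _); rewrite mxE.
under [in RHS]eq_bigr => m _.
  rewrite dE (_ : _ ^+ 2 = gradient (f m) x ord0 j ^+ 2 -
    2 * F * gradient (f m) x ord0 j + F ^+ 2); last by ring.
  over.
rewrite big_split sumrB /= -mulr_sumr FE sumr_const card_ord -mulr_natl.
by field.
Qed.

(** Each of the [n] indices enters with probability [B / n], so dividing by the expected size [B]
    gives total weight 1 to the common value [e]. *)
Lemma Rintegral_mul_device_gradient {d} {Omega : measurableType d}
    {R : realType} (P : probability Omega R) (n B : nat)
    (batch : Omega -> {set 'I_n}) (SX SY : set (set Omega))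
    (g : 'I_n -> Omega -> R) (Y : Omega -> R) (e : R) :
  (1 <= B <= n)%N -> poisson_sampling P (B%:R / n%:R) batch ->
  sigma_fin batch `<=` <<s SX >> ->
  independent_sigma P <<s SX >> <<s SY >> ->
  (forall i, measurable_fun [set: g_sigma_algebraType SY]
    (g i : g_sigma_algebraType SY -> R)) ->
  (forall i, sqintegrable P (g i)) ->
  measurable_fun [set: g_sigma_algebraType SY]
    (Y : g_sigma_algebraType SY -> R) ->
  sqintegrable P Y -> (forall i, \int[P]_o (Y o * g i o) = e) ->
  \int[P]_o (Y o * (B%:R^-1 * \sum_i (i \in batch o)%:R * g i o)) = e.
Proof.
move=> /andP[B1 Bn] bP bS SXY mg sg mY sY YgE.
have B0 : B%:R != 0 :> R by rewrite pnatr_eq0 -lt0n.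
have n0 : n%:R != 0 :> R by rewrite pnatr_eq0 -lt0n (leq_trans B1).
have iYg i : P.-integrable [set: Omega] (EFin \o (fun o => Y o * g i o)).
  exact: sqintegrable_mul.
have iYbg i : P.-integrable [set: Omega]
    (EFin \o (fun o => (i \in batch o)%:R * (Y o * g i o))).
  apply: integrable_bounded_mul => //; first exact: measurable_batch bP.
  by move=> o; case: (_ \in _); rewrite ?normr1 ?normr0.
have -> : \int[P]_o (Y o * (B%:R^-1 * \sum_i (i \in batch o)%:R * g i o)) =
    \int[P]_o (B%:R^-1 * \sum_i (i \in batch o)%:R * (Y o * g i o)).
  apply: eq_Rintegral => o _; rewrite mulrCA mulr_sumr; congr (_ * _).
  by apply: eq_bigr => i _; rewrite mulrCA.
rewrite RintegralZl//; last by apply: integrable_sumr => i _.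
rewrite Rintegral_sum//.
under eq_bigr => i _.
  rewrite (Rintegral_batch_mul P n _ batch SX SY i _ bP bS SXY)//.
  - rewrite YgE; over.
  - exact: measurable_funM.
rewrite sumr_const card_ord -mulr_natl.
by field; rewrite B0 n0.
Qed.

(** * One round in expectation *)

Lemma fedsgd_round {R : realType} {dO} {Omega : measurableType dO}
    (P : probability Omega R) (d M : nat) (n B : 'I_M -> nat)
    (f : 'I_M -> 'rV[R]_d -> R) (L lambda sigma G eta A1 A2 C1 C2 : R)
    (w : Omega -> 'rV[R]_d) (g : forall m, 'I_(n m) -> Omega -> 'rV[R]_d)
    (batch : forall m, Omega -> {set 'I_(n m)})
    (noise : Omega -> 'rV[R[i]]_d)
    (s := fun o => \row_j (M%:R^-1 * (\sum_(m < M)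
       device_gradient (B m) (batch m o) (fun i => g m i o) ord0 j) +
       complex.Re (noise o ord0 j) / Num.sqrt eta)) :
  (0 < M)%N -> (forall m, (1 <= B m <= n m)%N) ->
  (forall m x, differentiable (f m : _ -> R^o) x) ->
  0 < L -> 0 < lambda -> 0 < sigma -> 0 < eta ->
  (forall m i, random_vector (g m i)) ->
  (forall m i, {ae P, forall o, enorm (g m i o) <= G}) ->
  (forall m, poisson_sampling P ((B m)%:R / (n m)%:R) (batch m)) ->
  independent_sigma P <<s \bigcup_m sigma_fin (batch m) >>
    <<s sigma_vec w `|` \bigcup_m \bigcup_i sigma_vec (g m i) >> ->
  circular_gaussian P (sigma ^+ 2) noise ->
  independent_sigma P (sigma_cvec noise)
    <<s sigma_vec w `|` \bigcup_m sigma_fin (batch m)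
        `|` \bigcup_m \bigcup_i sigma_vec (g m i) >> ->
  (forall m i, unbiased_bounded_variance P A1 A2 w
     (fun o => gradient (f m) (w o)) (g m i)) ->
  0 <= A1 -> 0 <= C2 -> bounded_similarity C1 C2 f ->
  lambda * (4 * L * (C1 + 1) * (A1 + 1)) <= 1 ->
  [/\ forall j, sqintegrable P (fun o => gradient (global_loss f) (w o) ord0 j),
      forall j, sqintegrable P (fun o => s o ord0 j) &
      - lambda * (\sum_(j < d) \int[P]_o
          (gradient (global_loss f) (w o) ord0 j * s o ord0 j)) +
        L * lambda ^+ 2 / 2 * (\sum_(j < d) \int[P]_o (s o ord0 j ^+ 2)) <=
      - (lambda / 2) * (\sum_(j < d) \int[P]_o
          (gradient (global_loss f) (w o) ord0 j ^+ 2)) +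
        L * lambda ^+ 2 * (2 * C2 * (A1 + 1) + A2) +
        L * lambda ^+ 2 / 4 * (d%:R * sigma ^+ 2 / eta)].
Proof.
move=> M0 Bn df L0 lambda0 sigma0 eta0 mg gG bP bgI gN bgN ub A10 C20 fC lamL.
pose SW := \bigcup_(i in [set: 'I_d]) sigma_rv (fun o => w o ord0 i).
pose SX := \bigcup_m sigma_fin (batch m).
(* [SY] generates what the batches are independent of, [SZ] what the noise is independent of.
   Batches belong to the latter, so that the noiseless update [S] below is measurable for it. *)
pose SY := sigma_vec w `|` \bigcup_m \bigcup_i sigma_vec (g m i).
pose SZ := sigma_vec w `|` \bigcup_m sigma_fin (batch m)
  `|` \bigcup_m \bigcup_i sigma_vec (g m i).
have M0R : 0 < M%:R :> R by rewrite ltr0n.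
have wSY : sigma_vec w `<=` <<s SY >>.
  by move=> A wA; apply: sub_gen_smallest; left.
have wSZ : sigma_vec w `<=` <<s SZ >>.
  by move=> A wA; apply: sub_gen_smallest; left; left.
have gSY m i : sigma_vec (g m i) `<=` <<s SY >>.
  by move=> A gA; apply: sub_gen_smallest; right; exists m => //; exists i.
have gSZ m i : sigma_vec (g m i) `<=` <<s SZ >>.
  by move=> A gA; apply: sub_gen_smallest; right; exists m => //; exists i.
have bSX m : sigma_fin (batch m) `<=` <<s SX >>.
  by move=> A bA; apply: sub_gen_smallest; exists m.
have bSZ m : sigma_fin (batch m) `<=` <<s SZ >>.
  by move=> A bA; apply: sub_gen_smallest; left; right; exists m.
pose gf m o j := gradient (f m) (w o) ord0 j.
pose F j o := gradient (global_loss f) (w o) ord0 j.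
have mgf S m j : sigma_vec w `<=` <<s S >> ->
    measurable_fun [set: g_sigma_algebraType S]
      ((fun o => gf m o j) : g_sigma_algebraType S -> R).
  move=> wS; apply: (@measurable_gradient _ (g_sigma_algebraType S)) => // i.
  exact: measurable_sigma_vec.
have FE j : F j = fun o => M%:R^-1 * \sum_(m < M) gf m o j.
  by apply/funext => o; rewrite /F gradient_global_loss.
have mF S j : sigma_vec w `<=` <<s S >> ->
    measurable_fun [set: g_sigma_algebraType S]
      (F j : g_sigma_algebraType S -> R).
  move=> wS; rewrite FE; apply: measurable_funM => //.
  by apply: measurable_sum => m; exact: mgf.
have sg m i j : sqintegrable P (fun o => g m i o ord0 j).
  apply: (ae_bounded_sqintegrable _ G); first exact: mg.
  apply: filterS (gG m i) => o; apply: le_trans.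
  rewrite -(@ler_pXn2r _ 2)// ?nnegrE ?sqrtr_ge0//.
  rewrite enorm_sqrE real_normK ?num_real// (bigD1 j)//= lerDl sumr_ge0// => k _.
  exact: sqr_ge0.
have n0 m : (0 < n m)%N by have /andP[B1 /(leq_trans B1)] := Bn m.
(* The true gradient is recovered as a sample gradient, bounded by [G], minus its error. Any sample
   index serves, and [n m > 0] provides one. *)
have sgf m j : sqintegrable P (fun o => gf m o j).
  pose i0 := Ordinal (n0 m).
  have := sqintegrableB _ _ (sg m i0 j)
    (unbiased_sqintegrable P A1 A2 w _ _ j (ub m i0)).
  congr sqintegrable; apply/funext => o; rewrite mxE [X in _ - (_ + X)]mxE.
  by rewrite opprD opprK addNKr.
have sF j : sqintegrable P (F j).
  by rewrite FE; apply: sqintegrableZ; apply: sqintegrable_sum.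
pose D m j o := (B m)%:R^-1 * \sum_i (i \in batch m o)%:R * g m i o ord0 j.
have sD m j : sqintegrable P (D m j).
  apply: sqintegrableZ; apply: sqintegrable_sum => i _.
  exact: sqintegrable_batch_mul (bP m) _.
pose S j o := M%:R^-1 * \sum_(m < M) D m j o.
have sS j : sqintegrable P (S j).
  by apply: sqintegrableZ; apply: sqintegrable_sum.
pose N j o := complex.Re (noise o ord0 j) / Num.sqrt eta.
have sE o j : s o ord0 j = S j o + N j o.
  rewrite mxE; congr (_ * _ + _); apply: eq_bigr => m _.
  exact: device_gradientE.
have v0 : 0 < sigma ^+ 2 / 2 by rewrite divr_gt0// exprn_gt0.
have gRe j : gaussian_rv P (sigma ^+ 2 / 2) (fun o => complex.Re (noise o ord0 j)).
  by case: gN => gN _; exact: gN (j, false).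
have NE j : N j = fun o => (Num.sqrt eta)^-1 * complex.Re (noise o ord0 j).
  by apply/funext => o; rewrite mulrC.
have sRe j := gaussian_rv_sqintegrable P _ _ v0 (gRe j).
have sN j : sqintegrable P (N j) by rewrite NE; exact: sqintegrableZ.
have NN j : \int[P]_o (N j o ^+ 2) = sigma ^+ 2 / (2 * eta).
  rewrite NE (_ : \int[P]_o _ =
      \int[P]_o (eta^-1 * complex.Re (noise o ord0 j) ^+ 2)).
    rewrite RintegralZl ?(gaussian_rv_sqr P _ _ v0 (gRe j))//.
      by field; rewrite gt_eqF.
    by case: (sRe j).
  by apply: eq_Rintegral => o _; rewrite exprMn exprVn sqr_sqrtr// ltW.
(* Independence and the zero mean of the noise kill the cross terms. *)
have orthN j Y : measurable_fun [set: g_sigma_algebraType SZ]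
      (Y : g_sigma_algebraType SZ -> R) -> sqintegrable P Y ->
    \int[P]_o (N j o * Y o) = 0.
  move=> mY sY; have reN : sigma_vec (fun o => map_mx (@complex.Re R) (noise o))
      `<=` sigma_cvec noise.
    by move=> A nA; apply: sub_gen_smallest; left.
  have mRe := measurable_sigma_vec _ _ j reN.
  rewrite NE (_ : \int[P]_o _ = \int[P]_o ((Num.sqrt eta)^-1 *
      (complex.Re (noise o ord0 j) * Y o))); last first.
    by apply: eq_Rintegral => o _; rewrite mulrA.
  have iReY := sqintegrable_mul _ _ (sRe j) sY.
  rewrite RintegralZl// (Rintegral_mul_indep_sigma P _ SZ _ _ bgN)//.
  - by rewrite (gaussian_rv_mean P _ _ v0 (gRe j)) mul0r mulr0.
  - rewrite (_ : (fun o => complex.Re (noise o ord0 j)) =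
      fun o => map_mx (@complex.Re R) (noise o) ord0 j)//.
    by apply/funext => o; rewrite mxE.
  - exact: sqintegrable_integrable.
  - exact: sqintegrable_integrable.
have mS j : measurable_fun [set: g_sigma_algebraType SZ]
    (S j : g_sigma_algebraType SZ -> R).
  apply: measurable_funM => //; apply: measurable_sum => m.
  apply: measurable_funM => //; apply: measurable_sum => i.
  apply: measurable_funM; last exact: measurable_sigma_vec.
  exact: (measurable_sigma_fin (batch m) SZ (fun A => (i \in A)%:R)).
(* Noise drops out by [orthN]; on each device the batch and then the sampling error drop out,
   leaving the local gradient, and the average over devices restores [F j]. *)
have ND j : \int[P]_o (F j o * s o ord0 j) = \int[P]_o (F j o ^+ 2).
  have -> : \int[P]_o (F j o * s o ord0 j) =
      \int[P]_o (F j o * S j o + N j o * F j o).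
    by apply: eq_Rintegral => o _; rewrite sE mulrDr [N j o * _]mulrC.
  have iFS := sqintegrable_mul _ _ (sF j) (sS j).
  have iNF := sqintegrable_mul _ _ (sN j) (sF j).
  rewrite RintegralD// orthN//; last exact: mF.
  rewrite addr0.
  have -> : \int[P]_o (F j o * S j o) =
      \int[P]_o (M%:R^-1 * \sum_(m < M) F j o * D m j o).
    by apply: eq_Rintegral => o _; rewrite mulrCA mulr_sumr.
  have -> : \int[P]_o (F j o ^+ 2) =
      \int[P]_o (M%:R^-1 * \sum_(m < M) F j o * gf m o j).
    by apply: eq_Rintegral => o _; rewrite expr2 {2}FE mulrCA mulr_sumr.
  have iFD m := sqintegrable_mul _ _ (sF j) (sD m j).
  have iFgf m := sqintegrable_mul _ _ (sF j) (sgf m j).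
  rewrite !RintegralZl//; last 2 first.
  - by apply: integrable_sumr => m _.
  - by apply: integrable_sumr => m _.
  rewrite !Rintegral_sum//; congr (_ * _); apply: eq_bigr => m _.
  apply: (Rintegral_mul_device_gradient P (n m) (B m) (batch m) SX SY
    (fun i o => g m i o ord0 j) (F j) _ (Bn m) (bP m) (bSX m) bgI) => //.
  - by move=> i; exact: measurable_sigma_vec.
  - exact: mF.
  - move=> i; have oz := unbiased_Rintegral_mul P A1 A2 w _ _ j (F j) (ub m i)
      (mF _ j (@subset_refl _ _)) (sF j).
    have iFz := sqintegrable_mul _ _ (sF j)
      (unbiased_sqintegrable P A1 A2 w _ _ j (ub m i)).
    rewrite -[RHS]addr0 -oz -RintegralD//; apply: eq_Rintegral => o _.
    rewrite -mulrDr; congr (_ * _).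
    by rewrite mxE [X in _ + (_ + X)]mxE addrCA subrr addr0.
have SS j : \int[P]_o (s o ord0 j ^+ 2) =
    \int[P]_o (S j o ^+ 2) + sigma ^+ 2 / (2 * eta).
  have -> : \int[P]_o (s o ord0 j ^+ 2) =
      \int[P]_o (S j o ^+ 2 + (2 * (N j o * S j o) + N j o ^+ 2)).
    by apply: eq_Rintegral => o _; rewrite sE; ring.
  have [_ iS2] := sS j; have [_ iN2] := sN j.
  have iNS := sqintegrable_mul _ _ (sN j) (sS j).
  rewrite RintegralD//; last first.
    by apply: integrable_addr => //; exact: integrable_mulrl.
  rewrite RintegralD//; last exact: integrable_mulrl.
  by rewrite RintegralZl// orthN// mulr0 add0r NN.
pose Phi := \sum_(j < d) \int[P]_o (F j o ^+ 2).
have iF2 j : P.-integrable [set: Omega] (EFin \o (fun o => F j o ^+ 2)).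
  by case: (sF j).
have igf2 m j : P.-integrable [set: Omega] (EFin \o (fun o => gf m o j ^+ 2)).
  by case: (sgf m j).
have Phi0 : 0 <= Phi.
  by apply: sumr_ge0 => j _; apply: Rintegral_ge0 => o _; exact: sqr_ge0.
have gfPhi : M%:R^-1 * (\sum_(m < M) \sum_(j < d) \int[P]_o (gf m o j ^+ 2)) <=
    (C1 + 1) * Phi + C2.
  have -> : M%:R^-1 * (\sum_(m < M) \sum_(j < d) \int[P]_o (gf m o j ^+ 2)) =
      \int[P]_o (M%:R^-1 * \sum_(m < M) \sum_(j < d) gf m o j ^+ 2).
    rewrite RintegralZl//; last first.
      by apply: integrable_sumr => m _; apply: integrable_sumr => j _.
    rewrite Rintegral_sum; last by move=> m _; apply: integrable_sumr => j _.
    by congr (_ * _); apply: eq_bigr => m _; rewrite Rintegral_sum.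
  have iF2s : P.-integrable [set: Omega]
      (EFin \o (fun o => \sum_(j < d) F j o ^+ 2)).
    by apply: integrable_sumr => j _.
  have iC2 : P.-integrable [set: Omega] (EFin \o (fun=> C2)).
    exact: (finite_measure_integrable_cst P C2 measurableT).
  have -> : (C1 + 1) * Phi + C2 =
      \int[P]_o ((C1 + 1) * (\sum_(j < d) F j o ^+ 2) + C2).
    rewrite RintegralD//; last exact: integrable_mulrl.
    rewrite RintegralZl// Rintegral_sum// Rintegral_cst//; congr (_ + _).
    rewrite -[LHS]mulr1; congr (_ * _).
    exact: (esym (congr1 fine (probability_setT P))).
  apply: le_Rintegral => //.
  - apply: integrable_mulrl; apply: integrable_sumr => m _.
    by apply: integrable_sumr => j _.
  - by apply: integrable_addr => //; exact: integrable_mulrl.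
  - move=> o _; have := bounded_similarity_mean C1 C2 f (w o) M0 df fC.
    rewrite enorm_sqrE; apply: le_trans; rewrite ler_wpM2l ?invr_ge0 ?ler0n//.
    by apply: ler_sum => m _; rewrite enorm_sqrE.
have SPhi : \sum_(j < d) \int[P]_o (S j o ^+ 2) <=
    2 * ((A1 + 1) * ((C1 + 1) * Phi + C2) + A2).
  have iD2 m j : P.-integrable [set: Omega] (EFin \o (fun o => D m j o ^+ 2)).
    by case: (sD m j).
  apply: (@le_trans _ _ (\sum_(j < d) M%:R^-1 * \sum_(m < M)
      2 / (n m)%:R * \sum_i \int[P]_o (g m i o ord0 j ^+ 2))).
    apply: ler_sum => j _.
    apply: (@le_trans _ _ (\int[P]_o (M%:R^-1 * \sum_(m < M) D m j o ^+ 2))).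
      apply: le_Rintegral => //; first by case: (sS j).
        by apply: integrable_mulrl; apply: integrable_sumr => m _.
      by move=> o _; exact: sqr_mean_le.
    rewrite RintegralZl//; last by apply: integrable_sumr => m _.
    rewrite Rintegral_sum// ler_wpM2l ?invr_ge0 ?ler0n//; apply: ler_sum => m _.
    apply: (Rintegral_device_gradient_sqr P (n m) (B m) (batch m) SX SY
      (fun i o => g m i o ord0 j) (Bn m) (bP m) (bSX m) bgI) => // i.
    exact: measurable_sigma_vec.
  (* The coordinate sum has to move inside the sums over devices and samples before the variance
     bound, which controls only full norms, can be applied. *)
  rewrite -mulr_sumr exchange_big /=.
  apply: (@le_trans _ _ (M%:R^-1 * \sum_(m < M)
      2 * ((A1 + 1) * (\sum_(j < d) \int[P]_o (gf m o j ^+ 2)) + A2))).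
    rewrite ler_wpM2l ?invr_ge0 ?ler0n//; apply: ler_sum => m _.
    rewrite -mulr_sumr exchange_big /= -mulrA ler_wpM2l//.
    rewrite ler_pdivrMl ?ltr0n//.
    rewrite mulr_natl -[X in _ *+ X]card_ord -sumr_const; apply: ler_sum => i _.
    apply: (unbiased_second_moment P A1 A2 w _ _ (ub m i)) => j.
      exact: (mgf _ m j (@subset_refl _ _)).
    exact: sgf.
  rewrite -mulr_sumr big_split/= -mulr_sumr sumr_const card_ord.
  rewrite -[X in _ + X]mulr_natl mulrCA ler_wpM2l//.
  rewrite mulrDr mulKf ?gt_eqF// lerD2r mulrCA.
  by rewrite ler_wpM2l// addr_ge0.
have -> : \sum_(j < d) \int[P]_o
    (gradient (global_loss f) (w o) ord0 j * s o ord0 j) = Phi.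
  by apply: eq_bigr => j _; exact: ND.
have -> : \sum_(j < d) \int[P]_o (s o ord0 j ^+ 2) =
    \sum_(j < d) \int[P]_o (S j o ^+ 2) + d%:R * (sigma ^+ 2 / (2 * eta)).
  under eq_bigr do rewrite SS.
  by rewrite big_split/= sumr_const card_ord -[_ *+ d]mulr_natl.
split=> //.
  move=> j; rewrite (_ : (fun o => _) = fun o => S j o + N j o).
    exact: sqintegrableD.
  exact/funext.
set SPhi2 := \sum_(j < d) _ in SPhi *.
have -> : d%:R * (sigma ^+ 2 / (2 * eta)) = d%:R * sigma ^+ 2 / eta / 2.
  by field; rewrite gt_eqF.
set V := d%:R * sigma ^+ 2 / eta.
(* The step size makes the [Phi] part of the quadratic term, [L lambda^2 (A1 + 1) (C1 + 1) Phi], at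
   most [lambda Phi / 4]. What remains is [- 3/4 lambda Phi], below the claimed [- lambda Phi / 2];
   likewise [C2 (A1 + 1)] is bounded by its double. *)
have := ler_wpM2l (mulr_ge0 (ltW L0) (sqr_ge0 lambda)) SPhi.
have := ler_wpM2l (mulr_ge0 (ltW lambda0) Phi0) lamL.
rewrite -[\sum_(j < d) \int[P]_o (_ ^+ 2)]/Phi.
have := mulr_ge0 (ltW lambda0) Phi0.
have := mulr_ge0 (mulr_ge0 (ltW L0) (sqr_ge0 lambda))
  (mulr_ge0 (addr_ge0 A10 ler01) C20).
lra.
Qed.

(** * Summation over the rounds *)

Theorem theorem1
  (R : realType)
  (dO : measure_display) (Omega : measurableType dO) (P : probability Omega R)
  (dU : measure_display) (U : measurableType dU)
  (dV : measure_display) (V : measurableType dV)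
  (d M T : nat) (M_ge1 : (1 <= M)%N) (T_ge1 : (1 <= T)%N)
  (n B : 'I_M -> nat) (B_ge1 : forall m, (1 <= B m)%N)
  (B_le_n : forall m, (B m <= n m)%N)
  (* losses *)
  (p : 'I_M -> probability (U * V)%type R) (c : 'I_M -> R)
  (l : 'rV[R]_d -> (U * V)%type -> R)
  (l_integrable : forall m x,
     (p m).-integrable [set: (U * V)%type] (fun s => (c m * l x s)%:E))
  (f_ : 'I_M -> 'rV[R]_d -> R)
  (f_E : forall m x, f_ m x = local_loss (p m) (c m) l x)
  (f_differentiable : forall m x, differentiable (f_ m : _ -> R^o) x)
  (f : 'rV[R]_d -> R) (f_avg : forall x, f x = global_loss f_ x)
  (* the run; [xi t m i] is the random sample (u, o) behind [g t m i], and a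
     dataset kept over the rounds is the case of [xi] constant in [t] *)
  (L lambda sigma_n G : R) (eta : nat -> R)
  (L_gt0 : 0 < L) (lambda_gt0 : 0 < lambda) (sigma_n_gt0 : 0 < sigma_n)
  (eta_gt0 : forall t, (t < T)%N -> 0 < eta t)
  (h : nat -> 'I_M -> R[i])
  (h_neq0 : forall t m, (t < T)%N -> h t m != 0)
  (w0 : 'rV[R]_d) (w : nat -> Omega -> 'rV[R]_d)
  (xi : nat -> forall m : 'I_M, 'I_(n m) -> Omega -> (U * V)%type)
  (g : nat -> forall m : 'I_M, 'I_(n m) -> Omega -> 'rV[R]_d)
  (batch : nat -> forall m : 'I_M, Omega -> {set 'I_(n m)})
  (noise : nat -> Omega -> 'rV[R[i]]_d)
  (xi_measurable : forall t m i, (t < T)%N ->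
     measurable_fun [set: Omega] (xi t m i))
  (xi_law : forall t m i, (t < T)%N ->
     forall A, measurable A -> pushforward P (xi t m i) A = p m A)
  (l_differentiable : forall t m i, (t < T)%N ->
     {ae P, forall o,
        differentiable ((fun x => l x (xi t m i o)) : _ -> R^o) (w t o)})
  (g_E : forall t m i o, (t < T)%N ->
     g t m i o = c m *: gradient (fun x => l x (xi t m i o)) (w t o))
  (g_measurable : forall t m i, (t < T)%N -> random_vector (g t m i))
  (g_bounded : forall t m i, (t < T)%N ->
     {ae P, forall o, enorm (g t m i o) <= G})
  (batch_poisson : forall t m, (t < T)%N ->
     poisson_sampling P ((B m)%:R / (n m)%:R) (batch t m))
  (batch_indep : forall t, (t < T)%N ->
     independent_sigma P
       <<s \bigcup_m sigma_fin (batch t m) >>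
       <<s sigma_vec (w t) `|` \bigcup_m \bigcup_i sigma_vec (g t m i) >>)
  (noise_gaussian : forall t, (t < T)%N ->
     circular_gaussian P (sigma_n ^+ 2) (noise t))
  (noise_indep : forall t, (t < T)%N ->
     independent_sigma P
       (sigma_cvec (noise t))
       <<s sigma_vec (w t) `|` \bigcup_m sigma_fin (batch t m)
           `|` \bigcup_m \bigcup_i sigma_vec (g t m i) >>)
  (w_init : forall o, w 0%N o = w0)
  (w_step : forall t o, (t < T)%N ->
     w t.+1 o =
     server_update lambda (eta t) (w t o)
       (received (eta t) (h t)
          (fun m => device_gradient (B m) (batch t m o)
                      (fun i => g t m i o))
          (noise t o)))
  (* A1 *)
  (f_smooth : forall m, smooth L (f_ m))
  (* A2 *)
  (wstar : 'rV[R]_d) (fstar : R)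
  (f_wstar : f wstar = fstar) (f_min : forall x, fstar <= f x)
  (* A3 *)
  (A1 A2 : R) (A1_ge0 : 0 <= A1) (A2_ge0 : 0 <= A2)
  (g_unbiased : forall t m i, (t < T)%N ->
     unbiased_bounded_variance P A1 A2 (w t)
       (fun o => gradient (f_ m) (w t o)) (g t m i))
  (* A4 *)
  (C1 C2 : R) (C1_ge0 : 0 <= C1) (C2_ge0 : 0 <= C2)
  (f_similar : bounded_similarity C1 C2 f_)
  (lambda_le : lambda <= 1 / (4 * L * (C1 + 1) * (A1 + 1))) :
  let phi := 2 * (f w0 - fstar) / (lambda * T%:R)
             + 2 * L * lambda * (2 * C2 * (A1 + 1) + A2) in
  (((T%:R)^-1)%:E
     * \sum_(t < T) 'E_P[(fun o => enorm (gradient f (w t o)) ^+ 2)%R]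
   <= (phi + L * lambda / (2 * T%:R)
             * \sum_(t < T) (d%:R * sigma_n ^+ 2 / eta t))%R%:E)%E.
Proof.
cbv zeta.
have fE : f = global_loss f_ by apply/funext => x; exact: f_avg.
have LT := smooth_global_loss L f_ M_ge1 f_differentiable f_smooth.
have LCA : 0 < 4 * L * (C1 + 1) * (A1 + 1).
  have C10 : 0 < C1 + 1 by exact: ltr_wpDl.
  have A10 : 0 < A1 + 1 by exact: ltr_wpDl.
  by rewrite !mulr_gt0.
have lamL : lambda * (4 * L * (C1 + 1) * (A1 + 1)) <= 1.
  by rewrite -ler_pdivlMr.
have Bn m : (1 <= B m <= n m)%N by rewrite B_ge1 B_le_n.
have T0 : 0 < T%:R :> R by rewrite ltr0n.
pose s t o : 'rV[R]_d := \row_j (M%:R^-1 * (\sum_(m < M)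
   device_gradient (B m) (batch t m o) (fun i => g t m i o) ord0 j) +
   complex.Re (noise t o ord0 j) / Num.sqrt (eta t)).
pose F t j o := gradient f (w t o) ord0 j.
pose D t o := - lambda * (\sum_(j < d) F t j o * s t o ord0 j) +
  L * lambda ^+ 2 / 2 * \sum_(j < d) s t o ord0 j ^+ 2.
have round (t : 'I_T) := fedsgd_round P d M n B f_ L lambda sigma_n G (eta t)
  A1 A2 C1 C2 (w t) (g t) (batch t) (noise t) M_ge1 Bn f_differentiable L_gt0
  lambda_gt0 sigma_n_gt0 (eta_gt0 t (ltn_ord t))
  (fun m i => g_measurable t m i (ltn_ord t))
  (fun m i => g_bounded t m i (ltn_ord t))
  (fun m => batch_poisson t m (ltn_ord t)) (batch_indep t (ltn_ord t))
  (noise_gaussian t (ltn_ord t)) (noise_indep t (ltn_ord t))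
  (fun m i => g_unbiased t m i (ltn_ord t)) A1_ge0 C2_ge0 f_similar lamL.
rewrite -fE in LT round.
have descent t o : (t < T)%N -> f (w t.+1 o) <= f (w t o) + D t o.
  move=> tT; apply: smooth_step LT _ => j; rewrite (w_step t o tT).
  rewrite server_updateE//; [by rewrite mxE|exact: eta_gt0|].
  by move=> m; exact: h_neq0.
(* Both ends are deterministic: the start because [w 0] is constant, the end because [fstar] bounds
   the loss of the model [w T] left by round [T - 1]. Only the increments [D t] need to be
   integrable. *)
have path o : fstar - f w0 <= \sum_(t < T) D t o.
  rewrite lerBlDl; apply: (le_trans (f_min (w T o))).
  suff : forall k, (k <= T)%N -> f (w k o) <= f w0 + \sum_(t < k) D t o.
    by apply.
  elim=> [_|k IH kT]; first by rewrite big_ord0 addr0 w_init.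
  rewrite big_ord_recr addrA; apply: (le_trans (descent k o kT)).
  by rewrite lerD2r; apply: IH; exact: ltnW.
pose Phi t := \sum_(j < d) \int[P]_o (F t j o ^+ 2).
have iFs (t : 'I_T) j := let: And3 sF ss _ := round t in
  sqintegrable_mul _ _ (sF j) (ss j).
have is2 (t : 'I_T) j : P.-integrable [set: Omega]
    (EFin \o (fun o => s t o ord0 j ^+ 2)).
  by have [_ ss _] := round t; case: (ss j).
have iF2 (t : 'I_T) j : P.-integrable [set: Omega] (EFin \o (fun o => F t j o ^+ 2)).
  by have [sF _ _] := round t; case: (sF j).
have iFs' (t : 'I_T) : P.-integrable [set: Omega]
    (EFin \o (fun o => - lambda * (\sum_(j < d) F t j o * s t o ord0 j))).
  by apply: integrable_mulrl; apply: integrable_sumr => j _; exact: iFs.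
have is2' (t : 'I_T) : P.-integrable [set: Omega]
    (EFin \o (fun o => L * lambda ^+ 2 / 2 * \sum_(j < d) s t o ord0 j ^+ 2)).
  by apply: integrable_mulrl; apply: integrable_sumr => j _; exact: is2.
have iD (t : 'I_T) : P.-integrable [set: Omega] (EFin \o D t).
  exact: integrable_addr.
have ED (t : 'I_T) : \int[P]_o D t o <= - (lambda / 2) * Phi t +
    L * lambda ^+ 2 * (2 * C2 * (A1 + 1) + A2) +
    L * lambda ^+ 2 / 4 * (d%:R * sigma_n ^+ 2 / eta t).
  have [_ _] := round t; apply: le_trans.
  rewrite RintegralD// !RintegralZl//; last 2 first.
  - by apply: integrable_sumr => j _; exact: iFs.
  - by apply: integrable_sumr => j _; exact: is2.
  by rewrite !Rintegral_sum// => j _; exact: iFs.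
have : fstar - f w0 <= \sum_(t < T) \int[P]_o D t o.
  rewrite -Rintegral_sum//.
  have -> : fstar - f w0 = \int[P]_o (cst (fstar - f w0) o).
    rewrite Rintegral_cst// -[LHS]mulr1; congr (_ * _).
    exact: (esym (congr1 fine (probability_setT P))).
  apply: le_Rintegral => //.
    exact: (finite_measure_integrable_cst P _ measurableT).
  by apply: integrable_sumr => t _; exact: iD.
move=> /le_trans/(_ (ler_sum _ (fun t _ => ED t))).
rewrite !big_split/= -!mulr_sumr sumr_const card_ord -[_ *+ T]mulr_natl => H.
(* The expectation in the claim is an extended real; square-integrability of the gradient makes it
   finite and equal to the real number used so far. *)
have EPhi (t : 'I_T) :
    ('E_P[(fun o => enorm (gradient f (w t o)) ^+ 2)%R] = (Phi t)%:E)%E.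
  rewrite unlock /Phi -Rintegral_sum//.
  under eq_integral do rewrite enorm_sqrE.
  by rewrite /Rintegral fineK// integrable_fin_num//; exact: integrable_sumr.
rewrite (eq_bigr _ (fun t _ => EPhi t)) sumEFin -EFinM lee_fin.
set K := 2 * C2 * (A1 + 1) + A2 in H *.
set W := \sum_(t < T) Phi t in H *.
set E := \sum_(t < T) (eta t)^-1 in H *.
rewrite ler_pdivrMl//.
(* Up to the factor [2 / lambda], the inverse of the coefficient of [W] in [H], the target bound is
   the bound that [H] provides. *)
have -> : T%:R * (2 * (f w0 - fstar) / (lambda * T%:R) + 2 * L * lambda * K +
    L * lambda / (2 * T%:R) * (d%:R * sigma_n ^+ 2 * E)) =
    (f w0 - fstar + T%:R * (L * lambda ^+ 2 * K) +
     L * lambda ^+ 2 / 4 * (d%:R * sigma_n ^+ 2 * E)) * (2 / lambda).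
  by field; rewrite !gt_eqF.
rewrite -ler_pdivrMr ?divr_gt0// invf_div mulrC.
lra.
Qed.
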